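(* Under $p_n(\mathrm{id},\cdot)$, the random variable $\sigma_1$, denoting the number of the card in the first position, has the following behavior. (i) $$\lim_{n\to\infty} n\,p_n(\mathrm{id},\{\sigma_1=b_nn\})=e^{b-1},\quad\text{if } \lim_{n\to\infty}b_n=b\in(0,1].$$ In particular then, defining the probability measure $\nu_n^{F}$ on $[0,1]$ by $\nu_n^{F}(A)=p_n(\mathrm{id},\{\sigma_1\in nA\})$, $A\subset[0,1]$, one has the weak limit $$\text{w-}\lim_{n\to\infty}\nu_n^F(dx)=e^{-1}\delta_0(x)+e^{x-1}\,dx.$$ (ii) $$\lim_{n\to\infty} n\,p_n(\mathrm{id},\{\sigma_1=b_nn\})=e^{-1},\quad\text{if } \lim_{n\to\infty}b_n=0\ \text{ and }\ \liminf_{n\to\infty}\frac{n^{1/2}}{\sqrt{\log n}}\,b_n>\sqrt2.$$ (iii) $$\lim_{n\to\infty} n^{1/2}\,p_n(\mathrm{id},\{\sigma_1=d_nn^{1/2}\})=e^{-1}\int_d^\infty e^{-y^2/2}\,dy,\quad\text{if } \lim_{n\to\infty}d_n=d\in[0,\infty].$$ In particular then, defining the sub-probability measure $\mu_n^F$ on $[0,\infty)$ by $\mu_n^F(A)=p_n(\mathrm{id},\{\sigma_1\in n^{1/2}A\})$, $A\subset[0,\infty)$, one has the weak limit $$\text{w-}\lim_{n\to\infty}\mu_n^F(dx)=e^{-1}\Big(\int_x^\infty e^{-y^2/2}\,dy\Big)dx,$$ the total mass of the measure on the right hand side being $e^{-1}$.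
   Context: A permutation $\sigma\in S_n$ is viewed as a deck of cards numbered $1,\dots,n$ laid out in a row, where $\sigma_j$ is the number of the card in the $j$-th position from the left. The card-cyclic to random insertion shuffle removes and then randomly reinserts each of the $n$ cards exactly once (each reinsertion being in a uniformly random one of the $n$ positions, independently of the others), the removal and reinsertion being performed one card at a time in the original left-to-right order of the cards. Starting from the identity $\mathrm{id}$ (cards in increasing order from left to right), the cards are thus removed and reinserted in the order $1,2,\dots,n$. $p_n(\mathrm{id},\cdot)$ denotes the distribution on $S_n$ of the deck after one such shuffle started from $\mathrm{id}$. Here $b_nn$ and $d_nn^{1/2}$ are card numbers, i.e. integers in $\{1,\dots,n\}$. The symbol w-lim denotes the weak limit of measures, and $\delta_0$ the unit mass at $0$.
   Formalization: In (iii) the weak limit is taken against continuous functions vanishing at infinity (vague convergence), since each μ_n^F has total mass 1 while the limit has mass e^{-1}, so convergence against all bounded continuous functions fails (take f=1). *)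

(* Defs.v *)
From HB Require Import structures.
From mathcomp Require Import all_boot all_order all_algebra.
From mathcomp Require Import fingroup perm.
From mathcomp Require Import all_classical all_reals all_analysis.
From mathcomp Require Import measurable_realfun.

Set Implicit Arguments.
Unset Strict Implicit.
Unset Printing Implicit Defensive.

Import Order.TTheory GRing.Theory Num.Theory.
Import numFieldNormedType.Exports.

Local Open Scope classical_set_scope.
Local Open Scope ring_scope.

HB.instance Definition _ (T : finType) := isPointed.Build (perm_type T) 1%g.

HB.instance Definition _ (T : finType) :=
  @isMeasurable.Build default_measure_display (perm_type T) discrete_measurable
    discrete_measurable0 discrete_measurableC discrete_measurableU.

(* A deck of n.+1 cards is s : 'S_n.+1, where s j is the card in position j.
   Positions and cards are counted from 0 inside 'I_n.+1, so that i : 'I_n.+1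
   stands for the card numbered i.+1. *)
Section deck.
Context {n : nat}.
Implicit Types (s t : 'S_n.+1) (c j : 'I_n.+1).

(* Remove card c from the deck t and put it back in position j, the other cards
   keeping their relative order: see reinsert_at and reinsert_lift. *)
Definition reinsert t c j : 'S_n.+1 := (lift_perm j ((t^-1)%g c) 1 * t)%g.

Lemma reinsert_at t c j : reinsert t c j j = c.
Proof. by rewrite permM lift_perm_id permKV. Qed.

Lemma reinsert_lift t c j (k : 'I_n) :
  reinsert t c j (lift j k) = t (lift ((t^-1)%g c) k).
Proof. by rewrite permM lift_perm_lift perm1. Qed.

(* The i-th step moves the card s i, the one in position i of the original
   deck s, to position w i. *)
Definition card_cyclic_shuffle s (w : {ffun 'I_n.+1 -> 'I_n.+1}) : 'S_n.+1 :=
  foldl (fun t i => reinsert t (s i) (w i)) s (enum 'I_n.+1).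

Definition first_card s : nat := (s ord0).+1.

End deck.

(* p_{n.+1}(s, .): the insertion positions w are independent and uniform, i.e.
   w is uniform over all functions. *)
Section shuffle_law.
Context {R : realType} {n : nat} (s : 'S_n.+1).
Local Notation W := {ffun 'I_n.+1 -> 'I_n.+1}.

Definition shuffle_law (A : set 'S_n.+1) : \bar R :=
  (#|[pred w : W | card_cyclic_shuffle s w \in A]|%:R / #|{: W}|%:R)%:E.

Local Open Scope ereal_scope.

Let m (k : nat) : {measure set 'S_n.+1 -> \bar R} :=
  \d_(card_cyclic_shuffle s (nth [ffun=> ord0] (enum {: W}) k)).

Let N_ge0 : (0 <= (#|{: W}|%:R : R)^-1)%R.
Proof. by rewrite invr_ge0. Qed.

Let shuffle_lawE : shuffle_law = mscale (NngNum N_ge0) (msum m #|{: W}|).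
Proof.
apply/funext => A; rewrite /shuffle_law /mscale /msum /= EFinM muleC.
congr (_ * _).
transitivity (\sum_(w : W) (\d_(card_cyclic_shuffle s w) A : \bar R)).
  rewrite /dirac sumEFin; congr _%:E.
  under eq_bigr do rewrite indicE.
  rewrite -natr_sum -sum1_card; congr _%:R.
  by rewrite big_mkcond; apply: eq_bigr => w _; rewrite inE; case: (_ \in A).
rewrite -big_enum (big_nth [ffun=> ord0]) big_mkord -cardE.
exact: eq_bigr.
Qed.

Let shuffle_law0 : shuffle_law set0 = 0.
Proof. by rewrite shuffle_lawE measure0. Qed.

Let shuffle_law_ge0 A : 0 <= shuffle_law A.
Proof. by rewrite shuffle_lawE measure_ge0. Qed.

Let shuffle_law_sigma_additive : semi_sigma_additive shuffle_law.
Proof. by rewrite shuffle_lawE; exact: measure_semi_sigma_additive. Qed.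

HB.instance Definition _ := isMeasure.Build _ _ _ shuffle_law
  shuffle_law0 shuffle_law_ge0 shuffle_law_sigma_additive.

Let shuffle_lawT : shuffle_law setT = 1.
Proof.
rewrite /shuffle_law.
have -> : #|[pred w : W | card_cyclic_shuffle s w \in setT]| = #|{: W}|.
  by apply: eq_card => w; rewrite inE mem_set.
rewrite divff// pnatr_eq0 -lt0n; apply/card_gt0P; by exists [ffun=> ord0].
Qed.

HB.instance Definition _ := Measure_isProbability.Build _ _ _
  shuffle_law shuffle_lawT.

End shuffle_law.
Arguments shuffle_law R {n} s.

(* p_{n.+1}(id, {sigma_1 = x}). *)
Definition first_card_prob {R : realType} (n : nat) (x : R) : \bar R :=
  shuffle_law R (1%g : 'S_n.+1) [set s | (first_card s)%:R = x].

(* Borel measures on R live on measurableTypeR R, the measurable type carrying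
   lebesgue_measure; it is R with its Borel sets. *)
Definition first_card_over {R : realType} {n : nat} (a : R) (s : 'S_n.+1) :
  measurableTypeR R := (first_card s)%:R / a.

Lemma measurable_first_card_over (R : realType) (n : nat) (a : R) :
  measurable_fun setT (@first_card_over R n a).
Proof. by []. Qed.

HB.instance Definition _ (R : realType) (n : nat) (a : R) :=
  isMeasurableFun.Build _ _ _ _ (@first_card_over R n a)
    (measurable_first_card_over a).

(* Index n is for a deck of n.+1 cards: the law of the number of the first card
   divided by n.+1, resp. by sqrt n.+1, starting from the identity. *)
Definition nuF (R : realType) (n : nat) : probability (measurableTypeR R) R :=
  distribution (shuffle_law R (1%g : 'S_n.+1)) (first_card_over (n.+1%:R : R)).

Definition muF (R : realType) (n : nat) : probability (measurableTypeR R) R :=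
  distribution (shuffle_law R (1%g : 'S_n.+1))
    (first_card_over (Num.sqrt (n.+1%:R : R))).

Section limit_measures.
Context {R : realType}.
Local Open Scope ereal_scope.
Notation leb := (@lebesgue_measure R).

Lemma density_sigma_additive (D : set (measurableTypeR R))
    (g : measurableTypeR R -> \bar R) :
  measurable D -> measurable_fun setT g -> (forall x, 0 <= g x) ->
  semi_sigma_additive
    (fun A : set (measurableTypeR R) => \int[leb]_(x in A `&` D) g x).
Proof.
move=> mD mg g0 F mF tF mUF; apply: cvg_toP.
  apply: ereal_nondecreasing_is_cvgn => k l kl.
  by apply: lee_sum_nneg_natr => // i _ _; apply: integral_ge0 => x _;
    exact: g0.
rewrite setI_bigcupl ge0_integral_bigcup//=.
- by move=> i; exact: measurableI.
- exact: measurable_funTS.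
- apply/trivIsetP => /= i j _ _ ij; rewrite setIACA.
  by move/trivIsetP : tF => /(_ _ _ _ _ ij) ->//; rewrite set0I.
Qed.

Definition exp_part (A : set (measurableTypeR R)) : \bar R :=
  \int[leb]_(x in A `&` `[0%R, 1%R]) (expR (x - 1))%:E.

Let exp_part0 : exp_part set0 = 0.
Proof. by rewrite /exp_part set0I integral_set0. Qed.

Let exp_part_ge0 A : 0 <= exp_part A.
Proof. by apply: integral_ge0 => x _; rewrite lee_fin expR_ge0. Qed.

Let exp_part_sigma_additive : semi_sigma_additive exp_part.
Proof.
apply: (@density_sigma_additive _ (fun x => (expR (x - 1))%:E)) => //.
by apply/measurable_EFinP/measurableT_comp => //; exact: measurable_funB.
Qed.

HB.instance Definition _ := isMeasure.Build _ _ _ exp_part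
  exp_part0 exp_part_ge0 exp_part_sigma_additive.

Definition nuF_lim : {measure set (measurableTypeR R) -> \bar R} :=
  measure_add
    (mscale (NngNum (expR_ge0 (-1 : R))) (\d_(0%R : measurableTypeR R)))
    exp_part.

Definition gauss_tail (d : \bar R) : \bar R :=
  \int[leb]_(y in [set y : R | d <= y%:E]) (expR (- (y ^+ 2 / 2)))%:E.

Lemma gauss_tail_ge0 d : 0 <= gauss_tail d.
Proof. by apply: integral_ge0 => x _; rewrite lee_fin expR_ge0. Qed.

Let measurable_gauss : measurable_fun [set: measurableTypeR R]
  (fun y : measurableTypeR R => (expR (- (y ^+ 2 / 2)))%:E).
Proof.
apply/measurable_EFinP/measurableT_comp => //; apply: measurableT_comp => //.
by apply: measurable_funM => //; exact: exprn_measurable.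
Qed.

Let measurable_gauss_tail :
  measurable_fun [set: measurableTypeR R]
    (fun x : measurableTypeR R => gauss_tail x%:E).
Proof.
apply: (measurability _ (ErealGenOInfty.measurableE R)) => _ [_ [a ->] <-].
rewrite setTI; apply: is_interval_measurable => x y /=.
rewrite !in_itv/= !andbT => _ gy z /andP[_ zy]; rewrite in_itv/= andbT.
apply: (lt_le_trans gy).
have md (u : R) : measurable [set v : measurableTypeR R | u%:E <= v%:E].
  by rewrite (_ : [set _ | _] = `[u, +oo[%classic) //; apply/seteqP;
    split=> v /=; rewrite in_itv/= andbT lee_fin.
apply: ge0_subset_integral => //.
- exact: (measurable_funTS measurable_gauss).
- by move=> v /=; rewrite !lee_fin; exact: le_trans.
Qed.

Definition muF_density (x : R) : \bar R := (expR (-1))%:E * gauss_tail x%:E.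

Definition muF_lim (A : set (measurableTypeR R)) : \bar R :=
  \int[leb]_(x in A `&` `[0%R, +oo[) muF_density x.

Let muF_density_ge0 x : 0 <= muF_density x.
Proof. by rewrite mule_ge0 ?lee_fin ?expR_ge0 ?gauss_tail_ge0. Qed.

Let muF_lim0 : muF_lim set0 = 0.
Proof. by rewrite /muF_lim set0I integral_set0. Qed.

Let muF_lim_ge0 A : 0 <= muF_lim A.
Proof. exact: integral_ge0. Qed.

Let muF_lim_sigma_additive : semi_sigma_additive muF_lim.
Proof.
apply: density_sigma_additive => //.
by apply: emeasurable_funM.
Qed.

HB.instance Definition _ := isMeasure.Build _ _ _ muF_lim
  muF_lim0 muF_lim_ge0 muF_lim_sigma_additive.

End limit_measures.
Arguments nuF_lim R : clear implicits.
Arguments muF_lim R A : clear implicits.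

(* Measures on a Borel set D of reals are represented by measures on R, of which
   only the restriction to D is used. *)
Section weak_limits.
Context {R : realType}.
Variables (D : set R) (mu_ : nat -> {measure set (measurableTypeR R) -> \bar R})
  (mu : {measure set (measurableTypeR R) -> \bar R}).

Definition weak_limit := forall f : R -> R,
  {within D, continuous f} ->
  (exists M : R, forall x, D x -> `|f x| <= M) ->
  (\int[mu_ n]_(x in D) (f x)%:E)%E @[n --> \oo]
    --> (\int[mu]_(x in D) (f x)%:E)%E.

(* Weak limit of sub-probability measures: the test functions are the continuous
   functions on D that vanish at infinity, so that mass may escape to infinity.
   This is the notion needed for muF, whose total mass 1 drops to expR (-1) in
   the limit, which bounded continuous test functions would exclude. *)
Definition weak_limit_C0 := forall f : R -> R,
  {within D, continuous f} ->
  (forall e : R, 0 < e ->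
    exists M : R, forall x, D x -> M < `|x| -> `|f x| < e) ->
  (\int[mu_ n]_(x in D) (f x)%:E)%E @[n --> \oo]
    --> (\int[mu]_(x in D) (f x)%:E)%E.

End weak_limits.

(* x is one of the card numbers 1, ..., n. *)
Definition card_number {R : realType} (n : nat) (x : R) :=
  exists2 k : nat, (1 <= k <= n)%N & x = k%:R.

(* Main.v *)
(* Number the cards and positions from 0, let the deck have n+1 cards, and let
   [w i] be the position at which card i is reinserted.  Exactly one of two things
   decides the final first card.  If some card is reinserted at position 0, the
   last such card ends in front.  If not, then as long as no card has been put
   directly behind the unmoved front card, card i is in front just before step i,
   the unmoved cards following it are consecutive, and card i lands directly
   behind the unmoved card i + w i.  So the first unmoved card to reach the front
   with such a follower is m = min (i + w i); when m is removed at step m, its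
   follower, which is the last i with i + w i = m, becomes the first card and
   stays there.

   The first event, and the second one for each given m, are products of conditions
   on the single [w i]; this gives, with q = n / (n+1),
     P(sigma_1 = k) = q^(n-k) / (n+1) + q^(n+1) / n * sum_(k <= j < n) a_j
   where a_j = prod_(1 <= l <= j) (1 - l / n) is the birthday product.  The first
   term produces the density e^(x-1) on the scale n.  Since a_j is about
   e^(-j^2 / 2n), the second one lives on the scale sqrt n, where it produces the
   Gaussian tail by dominated convergence.  The mass e^(-1) of the limit on
   this scale is read off the total mass q^(n+1) of the second term. *)
Require Import Defs.
From HB Require Import structures.
From mathcomp Require Import all_boot all_order all_algebra.
From mathcomp Require Import fingroup perm.
From mathcomp Require Import all_classical all_reals all_analysis.
From mathcomp Require Import measurable_realfun.
From mathcomp Require Import zify ring lra.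

Set Implicit Arguments.
Unset Strict Implicit.
Unset Printing Implicit Defensive.

Import Order.TTheory GRing.Theory Num.Theory.
Import numFieldNormedType.Exports.

Local Open Scope classical_set_scope.
Local Open Scope ring_scope.

(** * The dynamics of the shuffle *)

Section first_card.
Context {n : nat}.
Local Notation W := {ffun 'I_n.+1 -> 'I_n.+1}.
Implicit Types (w : W) (i j k m x : 'I_n.+1).

(** [unbump] closes the gap left by [c], and [bump] opens the new one at [j]. *)
Lemma reinsert_position (t : 'S_n.+1) c j x : x != c ->
  (reinsert t c j)^-1%g x = bump j (unbump (t^-1%g c) (t^-1%g x)) :> nat.
Proof.
move=> xc; have : t^-1%g c != t^-1%g x by rewrite (inj_eq perm_inj) eq_sym.
case/unlift_some => q tx _.
have -> : (reinsert t c j)^-1%g x = lift j q.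
  by apply: (canLR (permK _)); rewrite reinsert_lift -tx permKV.
by rewrite tx /= bumpK.
Qed.

Lemma reinsert_position_same (t : 'S_n.+1) c j : (reinsert t c j)^-1%g c = j.
Proof. by apply: (canLR (permK _)); rewrite reinsert_at. Qed.

(** The index is a [nat] rather than an ordinal, so that [n.+1] can stand for the end of the
    shuffle. *)
Definition deck_after w (i : nat) : 'S_n.+1 :=
  foldl (fun t i => reinsert t ((1%g : 'S_n.+1) i) (w i)) 1%g
    (take i (enum 'I_n.+1)).

Definition position w (i : nat) x : nat := ((deck_after w i)^-1)%g x.

Lemma deck_after_all w : deck_after w n.+1 = card_cyclic_shuffle 1%g w.
Proof. by rewrite /deck_after take_oversize// size_enum_ord. Qed.

Lemma deck_afterS w i : deck_after w i.+1 = reinsert (deck_after w i) i (w i).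
Proof.
rewrite /deck_after (take_nth ord0) ?size_enum_ord// foldl_rcons.
by rewrite nth_ord_enum perm1.
Qed.

Lemma position0 w x : position w 0 x = x.
Proof. by rewrite /position /deck_after take0/= invg1 perm1. Qed.

Lemma positionS w i x : x != i ->
  position w i.+1 x = bump (w i) (unbump (position w i i) (position w i x)).
Proof. by move=> xi; rewrite /position deck_afterS reinsert_position. Qed.

Lemma positionS_same w i : position w i.+1 i = w i.
Proof. by rewrite /position deck_afterS reinsert_position_same. Qed.

Lemma position_eq0 w x :
  position w n.+1 x = 0 -> card_cyclic_shuffle 1%g w ord0 = x.
Proof.
rewrite /position deck_after_all => px.
by apply: (canLR (permKV _)); apply/val_inj; rewrite /= px.
Qed.

(** A card [x < i0] is not removed again, and every later insertion happens behind it. *)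
Lemma stays_first w x (i0 : nat) : (x < i0)%N -> (i0 <= n.+1)%N ->
  position w i0 x = 0 ->
  (forall i, (i0 <= i)%N -> (0 < w i)%N) -> position w n.+1 x = 0.
Proof.
move=> xi0 i0n p0 w0.
suff H d : (i0 + d <= n.+1)%N -> position w (i0 + d) x = 0.
  by have := H (n.+1 - i0)%N; rewrite subnKC//; exact.
elim: d => [|d ih]; first by rewrite addn0.
rewrite addnS => dn; have {}ih := ih (ltnW dn).
pose i := Ordinal dn.
have /negbTE xi : x != i by rewrite -val_eqE/=; lia.
have := positionS w (negbT xi); rewrite /= ih => ->.
have := w0 i (leq_addr _ _); rewrite /unbump /bump ltn0/=; lia.
Qed.

Lemma first_insertion w k : (w k = 0 :> nat) ->
  (forall i, (k < i)%N -> (0 < w i)%N) -> card_cyclic_shuffle 1%g w ord0 = k.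
Proof.
move=> wk wi; apply: position_eq0; apply: (@stays_first _ _ k.+1) => //.
by rewrite positionS_same.
Qed.

(* With m = k + w k, before step i <= m the unmoved cards i, ..., m are exactly
   the first m - i + 1 cards, and card k follows card m directly once
   reinserted. *)
Lemma first_argmin w k : (forall i, (0 < w i)%N) ->
  (forall i, (i < k)%N -> (k + w k <= i + w i)%N) ->
  (forall i, (k < i)%N -> (k + w k < i + w i)%N) ->
  card_cyclic_shuffle 1%g w ord0 = k.
Proof.
move=> w0 wlt wgt.
(* Comparison with card 0, whose sum [i + w i] is [w ord0 <= n]. *)
have mn : (k + w k < n.+1)%N.
  have [k0|k0] := posnP k; first by rewrite k0 add0n.
  by apply: (leq_ltn_trans (wlt ord0 k0)); rewrite add0n.
have [m mE] : exists m : 'I_n.+1, m = (k + w k)%N :> nat by exists (Ordinal mn).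
have km : (k < m)%N by have := w0 k; lia.
have front (d : nat) : (d <= m)%N ->
    forall x, (d <= x)%N -> (x <= m)%N -> position w d x = (x - d)%N.
  elim: d => [_ x _ _|d ih dm x dx xm]; first by rewrite position0 subn0.
  have [i iE] : exists i : 'I_n.+1, i = d :> nat.
    by exists (inord d); rewrite inordK//; have := ltn_ord m; lia.
  have xi : x != i by rewrite -val_eqE/=; lia.
  have mi : (m <= i + w i)%N.
    have := wlt i; have := wgt i; rewrite mE.
    case: (ltngtP i k) => [_ _ + |_ + _|ik _ _].
    - exact.
    - by move/(_ isT)/ltnW.
    - by rewrite (ord_inj ik).
  rewrite -iE in ih dm dx *.
  rewrite (positionS w xi) !ih; [|lia..].
  by rewrite /unbump /bump; lia.
(* Card [k] lands at [w k = m - k]. Each later step takes a card from the front and, by [wgt],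
   inserts it behind [k], so [k] advances by one. *)
have kpos d : (k < d)%N -> (d <= m)%N -> position w d k = (m - d).+1.
  elim: d => // d ih kd dm.
  have [i iE] : exists i : 'I_n.+1, i = d :> nat.
    by exists (inord d); rewrite inordK//; have := ltn_ord m; lia.
  rewrite -iE in ih kd dm *.
  have [ki|kltd] : k = i \/ (k < i)%N.
    by have [ki|ki] := ltnP k i; [right|left; apply/ord_inj; lia].
    by rewrite ki positionS_same /= -ki; have := w0 k; lia.
  have ki : k != i by rewrite -val_eqE/=; lia.
  rewrite (positionS w ki) ih ?front; [|lia..].
  have := wgt i kltd.
  by rewrite /unbump /bump; lia.
apply: position_eq0; apply: (@stays_first _ _ m.+1); [lia|exact: ltn_ord| |by []].
have km' : k != m by rewrite -val_eqE/=; lia.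
(* Step [m] removes the front card [m], so [k] moves from position 1 to 0, and [0 < w m] keeps it
   there. *)
rewrite (positionS w km') kpos// front// /unbump /bump.
have := w0 m; lia.
Qed.

Definition last_insertion k : pred W :=
  [pred w : W | (w k == 0 :> nat) &&
    [forall i : 'I_n.+1, (k < i)%N ==> (0 < w i)%N]].

(** Ties go to the last minimiser, and [0 < w i] makes the event disjoint from [last_insertion k].
    Once the value of [k + w k] is fixed, each condition bears on a single [w i]. *)
Definition last_argmin k : pred W :=
  [pred w : W | [forall i : 'I_n.+1,
    [&& (0 < w i)%N, (i < k)%N ==> (k + w k <= i + w i)%N &
        (k < i)%N ==> (k + w k < i + w i)%N]]].

Lemma last_insertion_or_argmin w :
  exists k, (w \in last_insertion k) || (w \in last_argmin k).
Proof.
have [/existsP[k0 wk0]|] := boolP [exists k, w k == 0 :> nat].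
  case: (@arg_maxnP _ k0 [pred k | w k == 0 :> nat] val wk0) => k wk kmax.
  rewrite /= in wk; exists k; apply/orP; left; rewrite inE wk/=; apply/forallP => i.
  apply/implyP => ki; rewrite lt0n; apply/negP => /kmax /=.
  lia.
rewrite negb_exists => /forallP w0.
case: (@arg_minnP _ (ord0 : 'I_n.+1) xpredT (fun i => i + w i)%N) => // i0 _ mini.
case: (@arg_maxnP _ i0 [pred i : 'I_n.+1 | i + w i == i0 + w i0]%N val (eqxx _)).
move=> k /eqP kk kmax; exists k; apply/orP; right; rewrite inE.
apply/forallP => i; rewrite lt0n w0/= kk mini// implybT/=.
apply/implyP => ki; rewrite ltn_neqAle mini// andbT eq_sym.
by apply/negP => /kmax /=; lia.
Qed.

(** For the direct implication, one of the events holds for some [j] and forces the first card to be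
    [j]; hence [j = k]. *)
Lemma shuffle_firstP w k :
  (card_cyclic_shuffle 1%g w ord0 == k) =
  (w \in last_insertion k) || (w \in last_argmin k).
Proof.
have H j : (w \in last_insertion j) || (w \in last_argmin j) ->
    card_cyclic_shuffle 1%g w ord0 = j.
  case/orP; rewrite inE.
    move=> /andP[/eqP w0 /forallP wj]; apply: first_insertion => // i.
    exact: (implyP (wj i)).
  move=> /forallP wj; apply: first_argmin => i; have /and3P[wi ij ji] := wj i.
  - by [].
  - exact: (implyP ij).
  - exact: (implyP ji).
apply/eqP/idP => [<-|]; last exact: H.
by have [j wj] := last_insertion_or_argmin w; rewrite (H _ wj).
Qed.

Lemma card_first k :
  #|[pred w : W | card_cyclic_shuffle 1%g w ord0 == k]| =
  (#|last_insertion k| + #|last_argmin k|)%N.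
Proof.
rewrite -cardUI [X in (_ + X)%N]eq_card0 ?addn0 => [|w].
  by apply: eq_card => w; rewrite !inE shuffle_firstP !inE.
rewrite !inE; apply/negP => /andP[/andP[/eqP w0 _]].
by move=> /forallP/(_ k)/and3P[]; rewrite w0.
Qed.

End first_card.

(** * Counting *)

Lemma card_ord_ge n (a : nat) : #|[pred x : 'I_n | (a <= x)%N]| = (n - a)%N.
Proof.
rewrite -sum1_card -[RHS]muln1 -sum_nat_const_nat big_geq_mkord /=.
by apply: eq_bigl => x; rewrite inE.
Qed.

(** This is how the independence of the insertion positions enters the counts. *)
Lemma card_ffun_forall (I T : finType) (F : I -> pred T) :
  #|[pred w : {ffun I -> T} | [forall i, F i (w i)]]| = (\prod_i #|F i|)%N.
Proof.
transitivity #|(family F : simpl_pred {dffun forall x : I, T})|.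
  by apply: eq_card => w; rewrite !inE.
by rewrite card_family foldrE big_map big_enum.
Qed.

(** Cards before [k] are free, card [k] has one choice, and each of the [n - k] later cards avoids
    position 0. *)
Lemma card_last_insertion n (k : 'I_n.+1) :
  #|last_insertion k| = (n.+1 ^ k * n ^ (n - k))%N.
Proof.
pose F (i : 'I_n.+1) : pred 'I_n.+1 := [pred x : 'I_n.+1 |
  ((i == k) ==> (x == ord0)) && ((k < i)%N ==> (0 < x)%N)].
transitivity (\prod_i #|F i|)%N.
  rewrite -card_ffun_forall; apply: eq_card => w; rewrite !inE /F /=.
  apply/andP/forallP => [[wk /forallP wi] i|wi].
    by rewrite wi andbT; apply/implyP => /eqP ->.
  split; first by have /andP[/implyP/(_ (eqxx k))] := wi k.
  by apply/forallP => i; have /andP[] := wi i.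
rewrite (bigD1_ord k)//= (fintype.eq_card1 (x := ord0)) ?mul1n; last first.
  by move=> x; rewrite !inE eqxx ltnn/= andbT.
transitivity (\prod_(i < n) (if (i < k)%N then n.+1 else n))%N.
  apply: eq_bigr => i _.
  (* The boolean [k <= i], read as 0 or 1, is the lower bound on the position. *)
  have -> : #|F (lift k i)| = #|[pred x : 'I_n.+1 | ((k <= i) <= x)%N]|.
    apply: eq_card => x; rewrite !inE.
    rewrite eq_sym (negbTE (neq_lift _ _)) /=.
    by rewrite /bump; case: (leqP k i) => /= ki; lia.
  by rewrite card_ord_ge; case: (leqP k i) => ki; rewrite ?subn0 ?subn1.
have kn : (k <= n)%N by rewrite -ltnS.
rewrite -(big_mkord xpredT (fun i => if (i < k)%N then n.+1 else n)).
rewrite (big_cat_nat (n := k)) //=; congr (_ * _)%N.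
  rewrite -[X in (_ ^ X)%N]subn0 -prod_nat_const_nat.
  by apply: eq_big_nat => i /andP[_ ->].
rewrite -prod_nat_const_nat; apply: eq_big_nat => i /andP[ki _].
by rewrite ltnNge ki.
Qed.

Lemma last_argmin_le n (k : 'I_n.+1) w :
  w \in last_argmin k -> (k < k + w k <= n)%N.
Proof.
rewrite inE => /forallP wP; have /and3P[wk _ _] := wP k.
have [k0|k0] := posnP k; first by have := ltn_ord (w k); lia.
have /and3P[_ /implyP/(_ k0) w0 _] := wP ord0.
rewrite add0n in w0.
by rewrite (leq_trans w0 (leq_ord _)) andbT; lia.
Qed.

(** Here [j.+1] is the minimum of [i + w i]; once it is fixed, the conditions on the separate [w i]
    multiply. *)
Lemma card_last_argmin_at n (k : 'I_n.+1) (j : nat) : (k <= j < n)%N ->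
  #|[pred w in last_argmin k | (k + w k)%N == j.+1]| =
  (n ^ (n - j) * \prod_(l < j) (n - l.+1))%N.
Proof.
move=> /andP[kj jn].
(* For [j < i] the truncated difference is 0 and the last condition reads [0 < x], so positivity is
   covered. *)
pose F (i : 'I_n.+1) : pred 'I_n.+1 := [pred x : 'I_n.+1 |
  [&& (i < k)%N ==> (j.+1 - i <= x)%N, (i == k) ==> (x == (j.+1 - k)%N :> nat)
    & (k < i)%N ==> (j.+1 - i < x)%N]].
transitivity (\prod_i #|F i|)%N.
  rewrite -card_ffun_forall; apply: eq_card => w; rewrite !inE /F /=.
  apply/andP/forallP => [[/forallP wP /eqP wk] i|wP].
    have /and3P[w0 wlt wgt] := wP i.
    apply/and3P; split; apply/implyP.
    - by move/(implyP wlt); lia.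
    - by move=> /eqP ->; apply/eqP; lia.
    - by move=> ki; have := implyP wgt ki; lia.
  have wk : (w k = j.+1 - k :> nat)%N.
    by have /and3P[_ /implyP/(_ (eqxx k))/eqP] := wP k.
  split; last by rewrite wk; apply/eqP; lia.
  apply/forallP => i; have /and3P[wlt _ wgt] := wP i.
  apply/and3P; split; last 2 first.
  - by apply/implyP => /(implyP wlt); rewrite wk; lia.
  - by apply/implyP => /(implyP wgt); rewrite wk; lia.
  have [/(implyP wlt)|/(implyP wgt)|ik] := ltngtP i k; [lia|lia|].
  by rewrite (ord_inj ik) wk; lia.
have jk : (j.+1 - k < n.+1)%N by lia.
rewrite (bigD1_ord k)//= (fintype.eq_card1 (x := Ordinal jk)) ?mul1n; last first.
  by move=> x; rewrite !inE eqxx ltnn/= andbT.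
(* Skipping [k] shifts the later indices by one, which turns their strict inequality into the bound
   [(j - i).+1 <= x] that holds for the earlier ones. *)
transitivity (\prod_(i < n) (n - (j - i)))%N.
  apply: eq_bigr => i _.
  have -> : #|F (lift k i)| = #|[pred x : 'I_n.+1 | ((j - i).+1 <= x)%N]|.
    apply: eq_card => x; rewrite !inE.
    rewrite [_ == k]eq_sym (negbTE (neq_lift _ _)) /=.
    by rewrite /bump; case: (leqP k i) => /= ki; lia.
  by rewrite card_ord_ge subSS.
rewrite -(big_mkord xpredT (fun i => n - (j - i)))%N.
rewrite (big_cat_nat (n := j)) //=; last exact: ltnW.
rewrite mulnC; congr (_ * _)%N.
  rewrite -prod_nat_const_nat; apply: eq_big_nat => i /andP[ki _]; lia.
rewrite big_nat_rev/= add0n big_mkord; apply: eq_bigr => i _.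
by have := ltn_ord i; lia.
Qed.

Lemma card_last_argmin n (k : 'I_n.+1) :
  #|last_argmin k| = (\sum_(k <= j < n) n ^ (n - j) * \prod_(l < j) (n - l.+1))%N.
Proof.
rewrite -sum1_card.
rewrite (partition_big (fun w : {ffun 'I_n.+1 -> 'I_n.+1} =>
  inord (k + w k) : 'I_n.+1) xpredT)//=.
(* The classes are indexed by the value of [k + w k]; the value 0 is impossible, and the others are
   the [j.+1]. *)
rewrite big_ord_recl big_geq_mkord [RHS]big_mkcond/= [X in (X + _)%N]big1 ?add0n.
  apply: eq_bigr => j _; case: ifPn => kj; last first.
    rewrite big1// => w /andP[/last_argmin_le/andP[kw wn]].
    by rewrite -val_eqE/= inordK ?ltnS// /bump/=; lia.
  rewrite -(card_last_argmin_at (k := k)) ?kj ?ltn_ord// -sum1_card; apply: eq_bigl => w.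
  rewrite !inE; apply: andb_id2l => wP.
  have /andP[kw wn] : (k < k + w k <= n)%N by apply: last_argmin_le; rewrite inE.
  by rewrite -val_eqE/= inordK ?ltnS.
move=> w /andP[/last_argmin_le/andP[kw wn]].
by rewrite -val_eqE/= inordK ?ltnS//; lia.
Qed.

(** * The exact law of the first card *)

Section probabilities.
Context {R : realType}.
Implicit Types n k j : nat.

(* The probability that a reinserted card avoids a given position. *)
Definition keep n : R := n%:R / n.+1%:R.

(** For [0 < n], the probability that [j.+1] uniform draws among [n] values are distinct. *)
Definition birthday n j : R := \prod_(l < j) (1 - l.+1%:R / n%:R).

Definition insertion_prob n k : R := keep n ^+ (n - k) / n.+1%:R.

Definition argmin_prob n k : R :=
  keep n ^+ n.+1 / n%:R * \sum_(k <= j < n) birthday n j.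

Lemma card_last_insertion_prob n k : (k <= n)%N ->
  (n.+1 ^ k * n ^ (n - k))%:R / (n.+1 ^ n.+1)%:R = insertion_prob n k.
Proof.
move=> kn; rewrite /insertion_prob /keep natrM !natrX expr_div_n.
have -> : n.+1%:R ^+ n.+1 = n.+1%:R * n.+1%:R ^+ (n - k) * n.+1%:R ^+ k :> R.
  by rewrite -mulrA -exprD subnK// exprS.
by field; rewrite ?nat1r ?expf_neq0 ?pnatr_eq0.
Qed.

Lemma card_last_argmin_prob n k :
  (\sum_(k <= j < n) n ^ (n - j) * \prod_(l < j) (n - l.+1))%:R /
    (n.+1 ^ n.+1)%:R = argmin_prob n k.
Proof.
rewrite /argmin_prob natr_sum !mulr_suml mulr_sumr.
apply: eq_big_nat => j /andP[kj jn].
have n0 : n%:R != 0 :> R by rewrite pnatr_eq0; lia.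
have -> : birthday n j = \prod_(l < j) (n - l.+1)%:R / n%:R ^+ j.
  rewrite -[in n%:R ^+ j](card_ord j) -prodr_const -prodf_div.
  apply: eq_bigr => l _; rewrite natrB; last by have := ltn_ord l; lia.
  by field.
rewrite natrM natr_prod !natrX /keep expr_div_n.
have -> : n%:R ^+ n.+1 = n%:R * n%:R ^+ (n - j) * n%:R ^+ j :> R.
  by rewrite -mulrA -exprD subnK ?(ltnW jn)// exprS.
by field; rewrite n0 ?expf_neq0// pnatr_eq0.
Qed.

Lemma first_card_probE n k : (k <= n)%N ->
  first_card_prob n k.+1%:R = (insertion_prob n k + argmin_prob n k)%:E.
Proof.
move=> kn; rewrite /first_card_prob /shuffle_law; congr EFin.
have kn' : (k < n.+1)%N by [].
rewrite -(card_last_insertion_prob kn) -card_last_argmin_prob.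
rewrite -(card_last_insertion (Ordinal kn')) -(card_last_argmin (Ordinal kn')).
rewrite -mulrDl -natrD -card_first card_ffun card_ord; congr (_%:R / _).
apply: eq_card => w; rewrite !inE; apply/idP/eqP => [|wk].
  rewrite inE/= => /eqP; rewrite eqr_nat /first_card eqSS => /eqP wk.
  exact/ord_inj.
by rewrite inE/= /first_card wk.
Qed.

End probabilities.

(** * Elementary estimates *)

Section bounds.
Context {R : realType}.
Implicit Types n k j : nat.
Local Notation keep := (@keep R).
Local Notation birthday := (@birthday R).
Local Notation argmin_prob := (@argmin_prob R).
Local Notation insertion_prob := (@insertion_prob R).

Lemma keepE n : keep n = 1 - n.+1%:R^-1.
Proof.
have n0 : n.+1%:R != 0 :> R by rewrite pnatr_eq0.
apply: (mulIf n0); rewrite mulrBl mulVf// mul1r divfK//.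
by rewrite -natr1 addrK.
Qed.

Lemma keep_ge0 n : 0 <= keep n.
Proof. by rewrite /keep. Qed.

Lemma keep_le1 n : keep n <= 1.
Proof. by rewrite keepE lerBlDr lerDl. Qed.

Lemma keepX_le n m : keep n ^+ m <= expR (- (m%:R / n.+1%:R)).
Proof.
rewrite -mulrN expRM_natl lerXn2r// ?nnegrE ?keep_ge0 ?expR_ge0//.
by rewrite keepE expR_ge1Dx.
Qed.

(** The inverse of [keep n] is [1 + n%:R^-1], which is at most [expR n%:R^-1]. *)
Lemma keepX_ge n m : (0 < n)%N -> expR (- (m%:R / n%:R)) <= keep n ^+ m.
Proof.
move=> n0; rewrite -mulrN expRM_natl lerXn2r// ?nnegrE ?keep_ge0 ?expR_ge0//.
have n0' : 0 < n%:R :> R by rewrite ltr0n.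
rewrite expRN -[keep n]invrK lef_pV2 ?posrE ?expR_gt0 ?invr_gt0 ?divr_gt0//.
rewrite (_ : (keep n)^-1 = 1 + n%:R^-1) ?expR_ge1Dx// /keep.
by field; lra.
Qed.

Lemma birthdayS n j : birthday n j.+1 = birthday n j * (1 - j.+1%:R / n%:R).
Proof. by rewrite /birthday big_ord_recr. Qed.

Lemma birthday_eq0 n j : (0 < n)%N -> (n <= j)%N -> birthday n j = 0.
Proof.
move=> n0; elim: j => [|j ih]; first by lia.
rewrite leq_eqVlt birthdayS => /predU1P[<-|nj].
  by rewrite divff ?subrr ?mulr0// pnatr_eq0; lia.
by rewrite ih ?mul0r.
Qed.

(** Negative factors occur only for [j] beyond [n], and then the product already contains the factor
    0. *)
Lemma birthday_ge0 n j : 0 <= birthday n j.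
Proof.
have [->|n0] := posnP n.
  (* For [n = 0], division by 0 gives 0, so every factor is 1. *)
  by rewrite /birthday prodr_ge0// => i _; rewrite invr0 mulr0 subr0.
have [nj|jn] := leqP n j; first by rewrite birthday_eq0.
rewrite prodr_ge0// => i _; rewrite subr_ge0 ler_pdivrMr ?ltr0n// mul1r ler_nat.
by have := ltn_ord i; lia.
Qed.

(** Each factor satisfies [1 - l / n <= expR (- (l / n))], and the exponents add up by
    [1 + ... + j = j (j + 1) / 2]. *)
Lemma birthday_le n j : birthday n j <= expR (- (j%:R * j.+1%:R / 2 / n%:R)).
Proof.
elim: j => [|j ih]; first by rewrite /birthday big_ord0 !mul0r oppr0 expR0.
rewrite birthdayS.
have [j1|j1] := leP 0 (1 - j.+1%:R / n%:R :> R); last first.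
  apply: (@le_trans _ _ 0); last exact: expR_ge0.
  by rewrite mulr_ge0_le0 ?birthday_ge0// ltW.
have -> : - (j.+1%:R * j.+2%:R / 2 / n%:R) =
    - (j%:R * j.+1%:R / 2 / n%:R) + - (j.+1%:R / n%:R) :> R.
  by rewrite -opprD -mulrDl; congr (- (_ * _)); field.
rewrite expRD ler_pM ?birthday_ge0//.
exact: expR_ge1Dx.
Qed.

(** Since [1 - l / n] is the inverse of [1 + l / (n - l)], it is at least [expR (- (l / (n - l)))];
    then [n - l] is replaced by the smaller [n - j], common to all factors. *)
Lemma birthday_ge n j : (j < n)%N ->
  expR (- (j%:R * j.+1%:R / 2 / (n%:R - j%:R))) <= birthday n j.
Proof.
move=> jn; have nj : 0 < n%:R - j%:R :> R by rewrite subr_gt0 ltr_nat.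
suff H i : (i <= j)%N ->
    expR (- (i%:R * i.+1%:R / 2 / (n%:R - j%:R))) <= birthday n i by exact: H.
elim: i => [|i ih] ij; first by rewrite /birthday big_ord0 !mul0r oppr0 expR0.
rewrite birthdayS.
have -> : - (i.+1%:R * i.+2%:R / 2 / (n%:R - j%:R)) =
    - (i%:R * i.+1%:R / 2 / (n%:R - j%:R)) + - (i.+1%:R / (n%:R - j%:R)) :> R.
  by rewrite -opprD -mulrDl; congr (- (_ * _)); field.
rewrite expRD ler_pM ?expR_ge0// ?ih 1?ltnW//.
have n0 : 0 < n%:R :> R by rewrite ltr0n; lia.
have ni : 0 < n%:R - i.+1%:R :> R by rewrite subr_gt0 ltr_nat; lia.
rewrite (_ : 1 - _ = (1 + i.+1%:R / (n%:R - i.+1%:R))^-1); last first.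
  by field; rewrite subrK nat1r !lt0r_neq0.
rewrite expRN lef_pV2 ?posrE ?expR_gt0 ?addr_gt0 ?divr_gt0//.
apply: (le_trans (expR_ge1Dx _)); rewrite ler_expR ler_pM2l//.
by rewrite lef_pV2 ?posrE// lerD2l lerN2 ler_nat.
Qed.

Lemma argmin_prob_ge0 n k : 0 <= argmin_prob n k :> R.
Proof.
rewrite mulr_ge0 ?divr_ge0 ?exprn_ge0 ?keep_ge0// sumr_ge0// => j _.
exact: birthday_ge0.
Qed.

Lemma insertion_prob_ge0 n k : 0 <= insertion_prob n k :> R.
Proof. by rewrite divr_ge0 ?exprn_ge0 ?keep_ge0. Qed.

(** Exchanging the sums counts [birthday n j] exactly [j.+1] times, and [j.+1 / n * birthday n j]
    telescopes as [birthday n j - birthday n j.+1]. *)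
Lemma sum_argmin_prob n : (0 < n)%N ->
  \sum_(k < n) argmin_prob n k = keep n ^+ n.+1.
Proof.
move=> n0.
have T m : \sum_(j < m) j.+1%:R / n%:R * birthday n j = 1 - birthday n m.
  elim: m => [|m ih]; first by rewrite big_ord0 /birthday big_ord0 subrr.
  by rewrite big_ord_recr/= ih birthdayS; ring.
rewrite /argmin_prob -mulr_sumr -mulrA -[RHS]mulr1; congr (_ * _).
have := T n; rewrite birthday_eq0// subr0 => Tn; rewrite -[RHS]Tn.
rewrite [in LHS](eq_bigr (fun k : 'I_n => \sum_(j < n | (k <= j)%N) birthday n j)).
  rewrite (exchange_big_dep xpredT)//= mulr_sumr; apply: eq_bigr => j _.
  rewrite -(big_ord_widen _ (fun=> birthday n j) (ltn_ord j)) sumr_const card_ord.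
  by rewrite -[_ *+ j.+1]mulr_natl mulrA [n%:R^-1 * _]mulrC.
by move=> k _; rewrite big_geq_mkord.
Qed.

(** From [t - 1 <= t ^+ 2 / 2] with [t = j / sqrt n.+1]. The Gaussian bound is weakened to a
    geometric one, which is easy to sum and to dominate. *)
Lemma birthday_le_exp n j : (0 < n)%N ->
  birthday n j <= expR 1 * expR (- (j%:R / Num.sqrt n.+1%:R)).
Proof.
move=> n0; apply: (le_trans (birthday_le _ _)); rewrite -expRD ler_expR.
set s := Num.sqrt _.
have s0 : 0 < s by rewrite sqrtr_gt0.
have s2 : s ^+ 2 = n.+1%:R by rewrite sqr_sqrtr.
have n0' : 0 < n%:R :> R by rewrite ltr0n.
have jj : (j%:R / s) ^+ 2 / 2 <= j%:R * j.+1%:R / 2 / n%:R.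
  rewrite expr_div_n s2 mulrAC ler_pM ?divr_ge0//.
    by rewrite ler_wpM2r// expr2 ler_wpM2l// ler_nat.
  by rewrite lef_pV2 ?posrE// ler_nat.
have := sqr_ge0 (j%:R / s - 1); rewrite sqrrB mulr1 expr1n.
by move: jj; set t := j%:R / s; lra.
Qed.

(** A geometric series of ratio [r = expR (- s^-1)], where [1 + s^-1 <= expR s^-1] gives
    [1 - r >= (s + 1)^-1]. *)
Lemma sum_expR_le (s : R) n k : 0 < s ->
  \sum_(k <= j < n) expR (- (j%:R / s)) <= (s + 1) * expR (- (k%:R / s)).
Proof.
move=> s0; set r := expR (- s^-1).
have s10 : 0 < s + 1 by rewrite addr_gt0.
have rs : r <= s / (s + 1).
  rewrite /r expRN -[leRHS]invrK lef_pV2 ?posrE ?expR_gt0 ?invr_gt0 ?divr_gt0//.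
  by rewrite invf_div mulrDl divff ?gt_eqF// mul1r expR_ge1Dx.
have [nk|kn] := leqP n k; first by rewrite big_geq// mulr_ge0 ?expR_ge0 ?ltW.
have E j : expR (- (j%:R / s)) = r ^+ j by rewrite -expRM_natl mulrN.
rewrite -ler_pdivrMl//.
apply: (@le_trans _ _ ((1 - r) * \sum_(k <= j < n) expR (- (j%:R / s)))).
  apply: ler_wpM2r; first by rewrite sumr_ge0// => j _; exact: expR_ge0.
  have -> : (s + 1)^-1 = 1 - s / (s + 1) by field; rewrite gt_eqF.
  by rewrite lerD2l lerN2.
rewrite mulr_sumr (eq_big_nat _ _ (F2 := fun j => - (r ^+ j.+1) - - (r ^+ j))).
  rewrite (telescope_sumr (fun j => - r ^+ j)) 1?ltnW// opprK E gerDr oppr_le0.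
  by rewrite exprn_ge0 ?expR_ge0.
by move=> j _; rewrite E exprS; ring.
Qed.

Lemma argmin_prob_le n k : (0 < n)%N ->
  Num.sqrt n.+1%:R * argmin_prob n k <=
  4 * expR 1 * expR (- (k%:R / Num.sqrt n.+1%:R)).
Proof.
move=> n0; set s := Num.sqrt _.
have n0' : 0 < n%:R :> R by rewrite ltr0n.
have s1 : 1 <= s by rewrite -sqrtr1 ler_sqrt// ler1n.
have s0 : 0 < s by exact: lt_le_trans s1.
have s2 : s ^+ 2 = n.+1%:R by rewrite sqr_sqrtr.
apply: (@le_trans _ _ (s * (n%:R^-1 *
    (expR 1 * ((s + 1) * expR (- (k%:R / s))))))).
  rewrite (ler_wpM2l (ltW s0))// /argmin_prob ler_pM//.
  - by rewrite divr_ge0 ?exprn_ge0 ?keep_ge0.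
  - by rewrite sumr_ge0// => j _; exact: birthday_ge0.
  - by rewrite ler_pdivrMr// mulVf ?gt_eqF// exprn_ile1 ?keep_ge0 ?keep_le1.
  - apply: (@le_trans _ _ (expR 1 * \sum_(k <= j < n) expR (- (j%:R / s)))).
      by rewrite mulr_sumr ler_sum// => j _; exact: birthday_le_exp.
    by rewrite ler_wpM2l ?expR_ge0// sum_expR_le.
rewrite (_ : s * _ = (s * (s + 1) / n%:R) * (expR 1 * expR (- (k%:R / s)))); last first.
  by ring.
rewrite -[leRHS]mulrA ler_wpM2r ?mulr_ge0 ?expR_ge0// ler_pdivrMr//.
(* Together with [n.+1 <= 2 * n] this produces the constant 4. *)
have : s * (s + 1) <= 2 * s ^+ 2 by nra.
move=> /le_trans; apply; rewrite s2.
by rewrite -natrM -natrM ler_nat; lia.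
Qed.

End bounds.

(** * Limits of the powers of [keep] and of the birthday products *)

Section limits.
Context {R : realType}.
Implicit Types (k : nat -> nat).
Local Notation keep := (@keep R).
Local Notation birthday := (@birthday R).

Lemma cvg_eq (u : nat -> R) (a b : R) : a = b ->
  u n @[n --> \oo] --> a -> u n @[n --> \oo] --> b.
Proof. by move=> ->. Qed.

Lemma cvg_invS : n.+1%:R^-1 @[n --> \oo] --> (0 : R).
Proof. exact: cvg_harmonic. Qed.

Lemma cvg_inv_sqrtS : (Num.sqrt n.+1%:R)^-1 @[n --> \oo] --> (0 : R).
Proof.
under eq_fun do rewrite -sqrtrV//.
apply: (cvg_eq (sqrtr0 R)).
apply: continuous_cvg; [exact: sqrt_continuous|exact: cvg_invS].
Qed.

(** Squeeze between the two exponential bounds; their denominators [n] and [n.+1] differ by the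
    factor [keep n], which tends to 1. *)
Lemma cvg_keepX k (c : R) : (k n)%:R / n.+1%:R @[n --> \oo] --> c ->
  keep n ^+ k n @[n --> \oo] --> expR (- c).
Proof.
move=> kc; apply: (@squeeze_cvgr _ _ _ _ (fun n => expR (- ((k n)%:R / n%:R)))
    (fun n => expR (- ((k n)%:R / n.+1%:R)))).
- near=> n; rewrite keepX_le andbT keepX_ge//.
  by near: n; exists 1.
- apply: continuous_cvg; first exact: continuous_expR.
  apply: cvgN.
  have keep1 : keep n @[n --> \oo] --> (1 : R).
    under eq_fun do rewrite keepE.
    by apply: (cvg_eq (subr0 _)); apply: cvgB; [exact: cvg_cst|exact: cvg_invS].
  apply: (cvg_eq (divr1 _)); apply: (@cvg_trans _ ((k n)%:R / n.+1%:R / keep n @[n --> \oo])).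
    apply: near_eq_cvg; near=> n.
    have n0 : (0 < n)%N by near: n; exists 1.
    by rewrite /keep; field; rewrite nat1r !pnatr_eq0; lia.
  by apply: cvgM => //; apply: cvgV => //; rewrite oner_eq0.
- apply: continuous_cvg; first exact: continuous_expR.
  exact: cvgN.
Unshelve. all: by end_near. Qed.

Lemma cvg_birthday k (y : R) :
  (k n)%:R / Num.sqrt n.+1%:R @[n --> \oo] --> y ->
  birthday n (k n) @[n --> \oo] --> expR (- (y ^+ 2 / 2)).
Proof.
move=> ky.
pose s n : R := Num.sqrt n.+1%:R.
have s0 n : 0 < s n by rewrite sqrtr_gt0.
have s2 n : n.+1%:R = s n ^+ 2 by rewrite sqr_sqrtr.
have is0 : (s n)^-1 @[n --> \oo] --> (0 : R) := cvg_inv_sqrtS.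
have kk : (k n)%:R * (k n).+1%:R / 2 / n.+1%:R @[n --> \oo] --> y ^+ 2 / 2.
  apply: (@cvg_eq _ (y * (y + 0) / 2)); first by rewrite addr0.
  under eq_fun => n.
    have -> : (k n)%:R * (k n).+1%:R / 2 / n.+1%:R =
      (k n)%:R / s n * ((k n)%:R / s n + (s n)^-1) / 2 :> R.
      by rewrite (s2 n) -[(k n).+1%:R]natr1; field; rewrite gt_eqF.
    over.
  by apply: cvgM; [apply: cvgM => //; apply: cvgD|exact: cvg_cst].
(* As [k n] is at most of order [sqrt n], the denominator [n - k n] of the lower bound is equivalent
   to [n.+1]. *)
have rest : (n%:R - (k n)%:R) / n.+1%:R @[n --> \oo] --> (1 : R).
  apply: (@cvg_eq _ (1 - 0 - y * 0)); first by rewrite mulr0 !subr0.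
  under eq_fun => n.
    have -> : (n%:R - (k n)%:R) / n.+1%:R =
      1 - n.+1%:R^-1 - (k n)%:R / s n * (s n)^-1 :> R.
      rewrite -keepE /keep mulrBl; congr (_ - _).
      by rewrite (s2 n); field; rewrite gt_eqF.
    over.
  apply: cvgB; last exact: cvgM.
  by apply: cvgB; [exact: cvg_cst|exact: cvg_invS].
have kn : \forall n \near \oo, (k n < n)%N.
  have /cvgr_gt/(_ _ ltr01) := rest; apply: filterS => n.
  by rewrite pmulr_lgt0// subr_gt0 ltr_nat.
apply: (@squeeze_cvgr _ _ _ _
    (fun n => expR (- ((k n)%:R * (k n).+1%:R / 2 / (n%:R - (k n)%:R))))
    (fun n => expR (- ((k n)%:R * (k n).+1%:R / 2 / n.+1%:R)))).
- near=> n.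
  have kn' : (k n < n)%N by near: n.
  rewrite birthday_ge//=; apply: (le_trans (birthday_le _ _)).
  rewrite ler_expR lerN2 ler_wpM2l ?divr_ge0//.
  by rewrite lef_pV2 ?posrE ?ltr0n ?ler_nat//; lia.
- apply: continuous_cvg; first exact: continuous_expR.
  apply: cvgN; apply: (cvg_eq (divr1 _)).
  apply: (@cvg_trans _ (((k n)%:R * (k n).+1%:R / 2 / n.+1%:R) /
    ((n%:R - (k n)%:R) / n.+1%:R) @[n --> \oo])).
    apply: near_eq_cvg; near=> n.
    have kn' : (k n < n)%N by near: n.
    have nk : n%:R - (k n)%:R != 0 :> R by rewrite gt_eqF// subr_gt0 ltr_nat.
    by field; rewrite nk nat1r pnatr_eq0.
  by apply: cvgM => //; apply: cvgV => //; rewrite oner_eq0.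
- apply: continuous_cvg; first exact: continuous_expR.
  exact: cvgN.
Unshelve. all: by end_near. Qed.

Lemma cvg_truncn (s : nat -> R) (x : R) : (forall n, 0 < s n) ->
  (s n)^-1 @[n --> \oo] --> (0 : R) -> 0 <= x ->
  (Num.truncn (x * s n))%:R / s n @[n --> \oo] --> x.
Proof.
move=> s0 is0 x0.
apply: (@squeeze_cvgr _ _ _ _ (fun n => x - (s n)^-1) (fun=> x)).
- near=> n; have s0n := s0 n.
  have /truncn_itv/andP[t1 t2] : 0 <= x * s n by rewrite mulr_ge0// ltW.
  rewrite ler_pdivrMr// t1 andbT ler_pdivlMr// mulrBl mulVf ?gt_eqF//.
  by rewrite lerBlDr natr1 ltW.
- by apply: (cvg_eq (subr0 _)); apply: cvgB; [exact: cvg_cst|exact: is0].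
- exact: cvg_cst.
Unshelve. all: by end_near. Qed.

End limits.

(** * Riemann sums *)

Section step_functions.
Context {R : realType}.
Local Notation leb := (@lebesgue_measure R).

Lemma measurable_truncn : measurable_fun [set: R] (@Num.truncn R).
Proof.
have mle n : measurable [set x : R | (Num.truncn x <= n)%N].
  rewrite (_ : [set _ | _] = `]-oo, n.+1%:R[%classic)//.
  by apply/seteqP; split=> x /=; rewrite in_itv/= truncn_le_nat.
move=> _ Y _; rewrite setTI.
rewrite (_ : _ @^-1` _ = \bigcup_(n in Y) [set x : R | Num.truncn x = n]); last first.
  by apply/seteqP; split=> [x Yx|x [n Yn /= nx]]; [exists (Num.truncn x)|rewrite /preimage/= nx].
apply: bigcup_measurable => n _; case: n => [|n].
  rewrite (_ : [set _ | _] = [set x : R | (Num.truncn x <= 0)%N])//.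
  by apply/seteqP; split=> x /=; lia.
rewrite (_ : [set _ | _] = [set x : R | (Num.truncn x <= n.+1)%N] `\`
  [set x : R | (Num.truncn x <= n)%N]).
  exact: measurableD.
by apply/seteqP; split=> x /=; lia.
Qed.

Lemma measurable_step (u : nat -> R) (s : R) (D : set R) :
  measurable_fun D (fun x => u (Num.truncn (x * s))).
Proof.
apply: (@measurable_funTS _ _ _ _ D).
apply: (@measurableT_comp _ _ _ _ _ _ u) => //.
apply: (measurableT_comp measurable_truncn).
exact: measurable_funM.
Qed.

(** The integrand is constant on the cells [[j / s, (j + 1) / s)] of length [s^-1] and vanishes
    beyond [K / s]; the induction adds one cell at a time. *)
Lemma integral_step (u : nat -> R) (s : R) (K : nat) : 0 < s ->
  (forall j, (K <= j)%N -> u j = 0) ->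
  (\int[leb]_(x in `[0%R, +oo[) (u (Num.truncn (x * s)))%:E =
   (s^-1 * \sum_(j < K) u j)%:E)%E.
Proof.
move=> s0 uK.
have mstep (D : set (measurableTypeR R)) :
    measurable_fun D (fun x : measurableTypeR R => (u (Num.truncn (x * s)))%:E).
  by apply/measurable_EFinP; exact: measurable_step.
have K0 (k : nat) : 0 <= k%:R / s by rewrite divr_ge0// ltW.
have -> : `[0%R, +oo[%classic = `[0%R, K%:R / s[ `|` `[K%:R / s, +oo[ :> set R.
  by rewrite -itv_bndbnd_setU// bnd_simp.
rewrite integral_setU//=; last first.
  apply/disj_setPS => x /=; rewrite !in_itv/= andbT => -[/andP[_ /lt_le_trans h] /h].
  by rewrite ltxx.
rewrite [X in (_ + X)%E]integral0_eq ?adde0; last first.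
  move=> x /=; rewrite in_itv/= andbT ler_pdivrMr// => Kx.
  by rewrite uK// truncn_ge_nat// (le_trans _ Kx).
elim: (K) => [|k ih].
  by rewrite mul0r set_itvco0 integral_set0 big_ord0 mulr0.
have kk : k%:R / s <= k.+1%:R / s by rewrite ler_pM2r ?invr_gt0// ler_nat.
have -> : `[0%R, k.+1%:R / s[%classic =
    `[0%R, k%:R / s[ `|` `[k%:R / s, k.+1%:R / s[ :> set R.
  by rewrite -itv_bndbnd_setU// bnd_simp.
rewrite integral_setU//=; last first.
  apply/disj_setPS => x /=; rewrite !in_itv/= => -[/andP[_ /lt_le_trans h] /andP[/h]].
  by rewrite ltxx.
rewrite ih big_ord_recr/= mulrDr EFinD; congr (_ + _)%E.
rewrite (eq_integral (cst (u k)%:E)); last first.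
  move=> x; rewrite inE/= in_itv/= ler_pdivrMr// ltr_pdivlMr// => kx.
  by rewrite (truncn_def kx).
rewrite integral_cst//= lebesgue_measure_itv/= lte_fin ltr_pM2r ?invr_gt0//.
rewrite ltr_nat ltnSn -EFinB -mulrBl -natrB// subSnn mul1r -EFinM.
by rewrite mulrC.
Qed.

Lemma integrable_expRN (M : R) :
  leb.-integrable `[0, +oo[ (fun x => (M * expR (- x))%:E).
Proof.
apply: (eq_integrable _ (fun x : measurableTypeR R =>
  (M%:E * (exponential_pdf (1 : R) x)%:E)%E)) => //.
  by move=> x; rewrite inE/= in_itv/= andbT => x0;
    rewrite exponential_pdfE// mul1r mulN1r EFinM.
apply: integrableZl => //.
apply: (@integrableS _ _ _ _ setT) => //.
by apply: integrable_exponential_pdf.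
Qed.

(** The scaled sum is the integral of a step function, to which dominated convergence applies.
    Convergence almost everywhere leaves room for the jumps of the limit. *)
Lemma cvg_sum_integral (u : nat -> nat -> R) (s : nat -> R) (K : nat -> nat)
    (h : R -> R) (M : R) :
  (forall n, 1 <= s n) ->
  (forall n j, (K n <= j)%N -> u n j = 0) ->
  (forall n j, `|u n j| <= M * expR (- (j%:R / s n))) ->
  measurable_fun (`[0%R, +oo[ : set (measurableTypeR R)) h ->
  {ae leb, forall x, 0 <= x -> u n (Num.truncn (x * s n)) @[n --> \oo] --> h x} ->
  ((s n)^-1 * \sum_(j < K n) u n j)%:E @[n --> \oo]
    --> (\int[leb]_(x in `[0%R, +oo[) (h x)%:E)%E.
Proof.
move=> s1 uK ub mh uh.
have s0 n : 0 < s n by exact: lt_le_trans (s1 n).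
have [] // := @dominated_convergence _ _ _ leb `[0%R, +oo[ (measurable_itv _)
  (fun n (x : measurableTypeR R) => (u n (Num.truncn (x * s n)))%:E) (EFin \o h)
  (fun x => (M * expR 1 * expR (- x))%:E).
- by move=> n; apply/measurable_EFinP; exact: measurable_step.
- exact/measurable_EFinP.
- apply: negligibleS uh => x /= nh xh; apply: nh.
  rewrite in_itv/= andbT => /xh xh0.
  by apply: cvg_EFin => //; exact: nearW.
- exact: integrable_expRN.
- apply: aeW => x n; rewrite /= in_itv/= andbT => x0.
  rewrite lee_fin; apply: (le_trans (ub _ _)).
  have M0 : 0 <= M.
    have := le_trans (normr_ge0 _) (ub 0 0).
    by rewrite pmulr_lge0 ?expR_gt0.
  (* Truncation lowers [x] by at most [(s n)^-1 <= 1], whence the factor [expR 1] in the dominating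
     function. *)
  rewrite -mulrA -expRD ler_wpM2l// ler_expR.
  rewrite lerNl opprD opprK ler_pdivlMr// mulrDl mulN1r.
  have := truncnS_gt (x * s n); have := s1 n; rewrite -natr1; lra.
- move=> _ _; apply: cvg_trans; apply: near_eq_cvg; apply: nearW => n /=.
  by rewrite (integral_step (K := K n)) //; exact: uK.
Qed.

End step_functions.

(** * Limits of the first card probabilities *)

Section first_card_limits.
Context {R : realType}.
Implicit Types (k : nat -> nat).
Local Notation leb := (@lebesgue_measure R).
Local Notation keep := (@keep R).
Local Notation birthday := (@birthday R).
Local Notation argmin_prob := (@argmin_prob R).
Local Notation insertion_prob := (@insertion_prob R).
Local Notation gauss y := (expR (- (y ^+ 2 / 2))).

Lemma measurable_gauss : measurable_fun [set: measurableTypeR R]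
  (fun y : measurableTypeR R => gauss y).
Proof.
apply: measurableT_comp => //; apply: measurableT_comp => //.
by apply: measurable_funM => //; exact: exprn_measurable.
Qed.

Lemma measurable_ge_ereal (d : \bar R) :
  measurable [set y : measurableTypeR R | (d <= y%:E)%E].
Proof.
rewrite (_ : [set _ | _] = EFin @^-1` `[d, +oo[%classic); last first.
  by apply/seteqP; split=> y /=; rewrite in_itv/= andbT.
rewrite -[_ @^-1` _]setTI.
have mE : measurable_fun [set: measurableTypeR R] (@EFin R).
  exact/measurable_EFinP.
by apply: mE => //; exact: emeasurable_itv.
Qed.

(** The integrand is dominated by [expR 1 * expR (- y)], because [y - 1 <= y ^+ 2 / 2]. *)
Lemma gauss_tail_fin_num (d : \bar R) : (0 <= d)%E -> gauss_tail d \is a fin_num.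
Proof.
move=> d0; apply: integrable_fin_num; first exact: measurable_ge_ereal.
apply: (@integrableS _ (measurableTypeR R) R leb `[0%R, +oo[) => //.
- exact: measurable_ge_ereal.
- by move=> y /= dy; rewrite in_itv/= andbT -lee_fin (le_trans d0).
apply: le_integrable (integrable_expRN (expR 1)) => //.
  by apply/measurable_EFinP; exact: measurable_funTS measurable_gauss.
move=> y /=; rewrite in_itv/= andbT => y0; rewrite lee_fin.
rewrite !ger0_norm ?mulr_ge0 ?expR_ge0// -expRD ler_expR.
have := sqr_ge0 (y - 1); lra.
Qed.

Lemma cvg_ereal_gt (t : nat -> R) (d : \bar R) (x : R) :
  (t n)%:E @[n --> \oo] --> d -> (x%:E < d)%E -> \forall n \near \oo, x < t n.
Proof.
case: d => [r| |]//.
  move=> /fine_cvg; rewrite lte_fin => tr xr.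
  exact: (cvgr_gt _ tr _ xr).
by move=> /cvgeryP/cvgryPgt/(_ x).
Qed.

Lemma negligible_eq_ereal (d : \bar R) : leb.-negligible [set x : R | x%:E = d].
Proof.
case: d => [r| |].
- exists [set r]; split => //; first exact: lebesgue_measure_set1.
  by move=> x /= [->].
- rewrite (_ : [set _ | _] = set0); first exact: negligible_set0.
  by apply/seteqP; split.
- rewrite (_ : [set _ | _] = set0); first exact: negligible_set0.
  by apply/seteqP; split.
Qed.

(** The sum over all [j < n], with the terms below [k n] set to 0, is a Riemann sum of the Gaussian
    cut off at [d]. The jump [x = d] is negligible, and for [d = +oo] the limit is 0. *)
Lemma cvg_sum_birthday k (d : \bar R) : (0 <= d)%E ->
  ((k n)%:R / Num.sqrt n.+1%:R)%:E @[n --> \oo] --> d ->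
  ((Num.sqrt n.+1%:R)^-1 * \sum_(k n <= j < n) birthday n j)%:E @[n --> \oo]
    --> gauss_tail d.
Proof.
move=> d0 kd.
pose s n : R := Num.sqrt n.+1%:R.
have s0 n : 0 < s n by rewrite sqrtr_gt0.
have s1 n : 1 <= s n by rewrite -sqrtr1 ler_sqrt// ler1n.
have is0 : (s n)^-1 @[n --> \oo] --> (0 : R) := cvg_inv_sqrtS.
pose u n j := if (k n <= j < n)%N then birthday n j else 0.
pose h := (fun y : R => gauss y) \_ [set y | (d <= y%:E)%E].
have hE : (\int[leb]_(x in `[0%R, +oo[) (h x)%:E)%E = gauss_tail d.
  have D : `[0%R, +oo[ `&` [set y : measurableTypeR R | (d <= y%:E)%E] =
      [set y : measurableTypeR R | (d <= y%:E)%E].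
    apply/seteqP; split=> [y []//|y /=]; rewrite in_itv/= andbT => dy.
    by split => //; rewrite -lee_fin (le_trans d0).
  rewrite /gauss_tail -D integral_mkcondr; apply: eq_integral => x _.
  by rewrite /h !patchE; case: ifPn.
rewrite -hE.
have -> : (fun n => ((s n)^-1 * \sum_(k n <= j < n) birthday n j)%:E) =
    (fun n => ((s n)^-1 * \sum_(j < n) u n j)%:E).
  apply/funext => n; congr (_ * _)%:E.
  rewrite big_geq_mkord big_mkcond/=; apply: eq_bigr => j _.
  by rewrite /u ltn_ord andbT.
apply: (@cvg_sum_integral _ u s id h (expR 1)) => //.
- by move=> n j nj; rewrite /u ltnNge nj andbF.
- move=> n j; rewrite /u; case: ifPn => [/andP[_ jn]|_]; last first.
    by rewrite normr0 mulr_ge0 ?expR_ge0.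
  by rewrite ger0_norm ?birthday_ge0// birthday_le_exp//; lia.
- apply: measurable_funTS.
  apply/(measurable_restrictT _ (measurable_ge_ereal d)).
  exact: measurable_funTS measurable_gauss.
apply: negligibleS (negligible_eq_ereal d) => x /= nx.
apply: contrapT => xd; apply: nx => x0.
have js : (Num.truncn (x * s n))%:R / s n @[n --> \oo] --> x.
  exact: cvg_truncn.
rewrite /h patchE; case: ifPn => [/set_mem/= dx|/negP dx].
- apply: (@cvg_trans _ (birthday n (Num.truncn (x * s n)) @[n --> \oo])).
    apply: near_eq_cvg.
    have dx' : (d < x%:E)%E by rewrite lt_neqAle dx andbT eq_sym; exact/eqP.
    (* Here [0 <= d < x], so [d] is finite. *)
    case: d d0 kd xd dx dx' {h hE} => [r| |]// d0 /fine_cvg kd _ _.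
    rewrite lte_fin => rx.
    near=> n; rewrite /u.
    have n0 : (0 < n)%N by near: n; exists 1.
    (* An index beyond [n] makes both sides 0. *)
    have [nj|jn] := leqP n (Num.truncn (x * s n)).
      by rewrite andbF birthday_eq0.
    rewrite andbT ifT// -(ler_nat R) -(ler_pM2r (_ : 0 < (s n)^-1)) ?invr_gt0//.
    apply: (@le_trans _ _ ((r + x) / 2)); apply: ltW; near: n.
      by apply: (cvgr_lt _ kd); rewrite midf_lt.
    by apply: (cvgr_gt _ js); rewrite midf_lt.
  exact: cvg_birthday.
- apply: cvg_near_cst.
  have dx' : (x%:E < d)%E.
    by rewrite ltNge; apply/negP => dx'; apply: dx; exact/mem_set.
  have := cvg_ereal_gt kd dx'; apply: filterS => n xk.
  rewrite /u ifF//; apply/negbTE; rewrite negb_and -ltnNge; apply/orP; left.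
  by rewrite truncn_lt_nat ?mulr_ge0 ?(ltW (s0 n))// -ltr_pdivlMr.
Unshelve. all: by end_near. Qed.

Lemma cvg_keep : keep n ^+ n.+1 @[n --> \oo] --> expR (-1).
Proof.
apply: cvg_keepX; apply: cvg_near_cst; apply: nearW => n.
by rewrite divff// pnatr_eq0.
Qed.

Lemma cvg_nSn : n.+1%:R / n%:R @[n --> \oo] --> (1 : R).
Proof.
apply: (@cvg_trans _ ((1 - n.+1%:R^-1)^-1 @[n --> \oo])).
  apply: near_eq_cvg; near=> n.
  have n0 : (0 < n)%N by near: n; exists 1.
  by rewrite -keepE /keep invf_div.
apply: (cvg_eq (invr1 _)); apply: cvgV; first exact: oner_neq0.
by apply: (cvg_eq (subr0 _)); apply: cvgB; [exact: cvg_cst|exact: cvg_invS].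
Unshelve. all: by end_near. Qed.

(** With [s = sqrt n.+1], the prefactor [s / n] splits as [(n.+1 / n) * s^-1], and [s^-1] normalises
    the Riemann sum. *)
Lemma cvg_argmin_prob k (d : \bar R) : (0 <= d)%E ->
  ((k n)%:R / Num.sqrt n.+1%:R)%:E @[n --> \oo] --> d ->
  Num.sqrt n.+1%:R * argmin_prob n (k n) @[n --> \oo]
    --> expR (-1) * fine (gauss_tail d).
Proof.
move=> d0 kd.
have /fine_cvg T : ((Num.sqrt n.+1%:R)^-1 * \sum_(k n <= j < n) birthday n j)%:E
    @[n --> \oo] --> (fine (gauss_tail d))%:E.
  by rewrite fineK ?gauss_tail_fin_num//; exact: cvg_sum_birthday.
apply: (@cvg_trans _ (keep n ^+ n.+1 * (n.+1%:R / n%:R) *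
  ((Num.sqrt n.+1%:R)^-1 * \sum_(k n <= j < n) birthday n j) @[n --> \oo]));
    last first.
  by rewrite -[expR (-1)]mulr1; exact: cvgM (cvgM cvg_keep cvg_nSn) T.
apply: near_eq_cvg; apply: nearW => n /=.
have s0 : 0 < Num.sqrt n.+1%:R :> R by rewrite sqrtr_gt0.
have s2 : n.+1%:R = Num.sqrt n.+1%:R ^+ 2 :> R by rewrite sqr_sqrtr.
rewrite /argmin_prob [X in _ * (X / _) * _ = _]s2.
set s := Num.sqrt _; rewrite -/s in s0.
by set c := n%:R^-1; field; rewrite gt_eqF.
Qed.

End first_card_limits.

(** * Limits on the scale [n] *)

Section first_card_prob_limits.
Context {R : realType}.
Local Notation leb := (@lebesgue_measure R).
Local Notation keep := (@keep R).
Local Notation birthday := (@birthday R).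
Local Notation argmin_prob := (@argmin_prob R).
Local Notation insertion_prob := (@insertion_prob R).

Lemma cvg_insertion_prob (k : nat -> nat) (c : R) : (forall n, (k n <= n)%N) ->
  (k n)%:R / n.+1%:R @[n --> \oo] --> c ->
  n.+1%:R * insertion_prob n (k n) @[n --> \oo] --> expR (c - 1).
Proof.
move=> kn kc; rewrite -[c - 1]opprB.
have -> : (fun n => n.+1%:R * insertion_prob n (k n)) =
    (fun n => keep n ^+ (n - k n)).
  by apply/funext => n; rewrite /insertion_prob mulrC divfK ?pnatr_eq0.
apply: cvg_keepX.
have -> : (fun n => (n - k n)%:R / n.+1%:R) =
    (fun n => 1 - n.+1%:R^-1 - (k n)%:R / n.+1%:R) :> (nat -> R).
  by apply/funext => n; rewrite natrB// mulrBl -[n%:R / _]/(keep n) keepE.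
apply: cvgB => //; apply: (cvg_eq (subr0 _)).
by apply: cvgB; [exact: cvg_cst|exact: cvg_invS].
Qed.

Lemma ln_nat_cvgy : ln (n.+1%:R : R) @[n --> \oo] --> +oo.
Proof.
apply/cvgryPge => A; near=> n.
rewrite -[A]expRK ler_ln ?posrE ?expR_gt0//.
near: n; exists (Num.bound (expR A)) => // n /= An.
apply/ltW/(lt_le_trans (archi_boundP (expR_ge0 A))).
by rewrite ler_nat; apply: leq_trans An _.
Unshelve. all: by end_near. Qed.

(** The sum has at most [n] terms, all below the bound for [j = k], and the factor [n%:R^-1]
    compensates their number. *)
Lemma argmin_prob_le_gauss (n k : nat) : (0 < n)%N ->
  n.+1%:R * argmin_prob n k <=
  n.+1%:R * expR (- (k%:R * k.+1%:R / 2 / n%:R)).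
Proof.
move=> n0; rewrite ler_wpM2l//.
have n0' : 0 < n%:R :> R by rewrite ltr0n.
apply: (@le_trans _ _ (n%:R^-1 * \sum_(k <= j < n) expR (- (k%:R * k.+1%:R / 2 / n%:R)))).
  apply: ler_pM.
  - by rewrite divr_ge0 ?exprn_ge0 ?keep_ge0.
  - by rewrite sumr_ge0// => j _; exact: birthday_ge0.
  - by rewrite ler_pdivrMr// mulVf ?gt_eqF// exprn_ile1 ?keep_ge0 ?keep_le1.
  - rewrite !big_nat; apply: ler_sum => j /andP[kj _].
    apply: (le_trans (birthday_le _ _)); rewrite ler_expR lerN2 ler_pM2r ?invr_gt0//.
    by rewrite ler_pM2r ?invr_gt0// ler_pM// ler_nat.
rewrite sumr_const_nat -[_ *+ (n - k)]mulr_natl mulrA ler_piMl ?expR_ge0//.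
by rewrite ler_pdivrMl// mulr1 ler_nat leq_subr.
Qed.

(** For [k.+1 >= c * sqrt (n.+1 * ln n.+1)] the Gaussian factor is of order at most [n.+1] to the
    power [- c ^+ 2 / 2]. It beats the factor [n.+1] because [c ^+ 2 / 2 > 1], which is where
    [sqrt 2] comes from. *)
Lemma cvg_argmin_prob_large (k : nat -> nat) (c : R) : Num.sqrt 2 < c ->
  (forall n, (k n <= n)%N) ->
  (\forall n \near \oo, c * (Num.sqrt n.+1%:R * Num.sqrt (ln n.+1%:R)) <= (k n).+1%:R) ->
  n.+1%:R * argmin_prob n (k n) @[n --> \oo] --> (0 : R).
Proof.
move=> c2 kn ck.
have c0 : 0 < c by apply: le_lt_trans c2; exact: sqrtr_ge0.
have cc : 2 < c ^+ 2.
  by rewrite -[ltLHS](@sqr_sqrtr _ 2)// ltr_pXn2r ?nnegrE ?sqrtr_ge0// ltW.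
pose a := c ^+ 2 / 2 - 1.
have a0 : 0 < a by rewrite /a; lra.
apply: (@squeeze_cvgr _ _ _ _ (fun=> 0)
  (fun n => expR 1 * expR (- (a * ln n.+1%:R)))).
- near=> n; rewrite mulr_ge0 ?argmin_prob_ge0//=.
  have n0 : (0 < n)%N by near: n; exists 1.
  have n0' : 0 < n%:R :> R by rewrite ltr0n.
  apply: (le_trans (argmin_prob_le_gauss _ n0)).
  have ln0 : 0 <= ln n.+1%:R :> R by rewrite ln_ge0// ler1n.
  rewrite -[X in X * _](@lnK _ n.+1%:R) ?posrE// -!expRD ler_expR.
  have : c * (Num.sqrt n.+1%:R * Num.sqrt (ln n.+1%:R)) <= (k n).+1%:R by near: n.
  rewrite -(ler_pXn2r (ltn0Sn 1)) ?nnegrE ?mulr_ge0 ?sqrtr_ge0 ?(ltW c0)//.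
  rewrite !exprMn !sqr_sqrtr// => H.
  have kn' : (k n).+1%:R <= n.+1%:R :> R by rewrite ler_nat ltnS.
  have : (k n)%:R * (k n).+1%:R / 2 / n.+1%:R <= (k n)%:R * (k n).+1%:R / 2 / n%:R :> R.
    by rewrite ler_wpM2l ?divr_ge0// lef_pV2 ?posrE// ler_nat.
  (* Replacing [k.+1 ^+ 2] by [k * k.+1] costs at most 1, as [k.+1 <= n.+1]. *)
  have : c ^+ 2 * ln n.+1%:R / 2 - 1 <= (k n)%:R * (k n).+1%:R / 2 / n.+1%:R.
    rewrite ler_pdivlMr// mulrBl mul1r.
    have aux (x K N L : R) : 0 <= N -> x * (N * L) <= (K + 1) ^+ 2 ->
        K + 1 <= N -> x * L / 2 * N - N <= K * (K + 1) / 2 by nra.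
    by move: H kn'; rewrite -[(k n).+1%:R]natr1; exact: aux.
  have aux (x L P Q : R) : x * L / 2 - 1 <= P -> P <= Q ->
    L - Q <= 1 - (x / 2 - 1) * L by nra.
  exact: aux.
- exact: cvg_cst.
- have lny : a * ln n.+1%:R @[n --> \oo] --> +oo.
    apply/cvgryPge => A; have /cvgryPge/(_ (A / a)) := ln_nat_cvgy.
    by apply: filterS => n; rewrite ler_pdivrMr// mulrC.
  have ey : expR (- (a * ln n.+1%:R)) @[n --> \oo] --> (0 : R).
    exact: (cvg_comp _ _ lny (@cvgr_expR R)).
  by apply: (cvg_eq (mulr0 (expR 1))); apply: cvgM => //; exact: cvg_cst.
Unshelve. all: by end_near. Qed.

(** The limit inferior is the supremum of the tail infima, so some tail infimum exceeds [a]. It is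
    not [+oo], being below a real term, and serves as [c]. *)
Lemma limn_einf_gt (u : nat -> R) (a : R) :
  (a%:E < limn_einf (fun n => (u n)%:E))%E ->
  exists2 c, a < c & \forall n \near \oo, c <= u n.
Proof.
rewrite limn_einf_lim (cvg_lim _ (@cvg_einfs_sup _ _))//.
move=> /ereal_sup_gt[_ [N _ <-]] aN.
have uN n : (N <= n)%N -> (einfs (fun n => (u n)%:E) N <= (u n)%:E)%E.
  by move=> Nn; apply: ereal_inf_lbound; exists n.
case E : (einfs _ N) aN uN => [r| |]// aN uN.
  exists r; first by rewrite -lte_fin.
  by exists N => // n /= /uN; rewrite lee_fin.
by have := uN N (leqnn N); rewrite leye_eq.
Qed.

(** Common source of (i) and (ii): above the threshold the argmin term vanishes, and the insertion
    term alone gives the limit. *)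
Lemma cvg_first_card_prob (b : nat -> R) (beta c : R) :
  (forall n, (0 < n)%N -> card_number n (b n * n%:R)) ->
  b n @[n --> \oo] --> beta ->
  Num.sqrt 2 < c ->
  (\forall n \near \oo, c <= Num.sqrt n%:R / Num.sqrt (ln n%:R) * b n) ->
  (n.+1%:R%:E * first_card_prob n (b n.+1 * n.+1%:R))%E @[n --> \oo]
    --> (expR (beta - 1))%:E.
Proof.
move=> bn bb c2 cb.
have /choice[k kP] : forall n, exists k, (k <= n)%N /\ b n.+1 * n.+1%:R = k.+1%:R.
  move=> n; have [//|[|k] /andP[//k0 kn] ->] := bn n.+1.
  by exists k.
have kn n : (k n <= n)%N by have [] := kP n.
have bk n : b n.+1 * n.+1%:R = (k n).+1%:R by have [] := kP n.
have bS : b n.+1 @[n --> \oo] --> beta by rewrite (cvg_shiftS b).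
have E : (fun n => (n.+1%:R%:E * first_card_prob n (b n.+1 * n.+1%:R))%E) =
    (fun n => (n.+1%:R * insertion_prob n (k n) +
               n.+1%:R * argmin_prob n (k n))%:E).
  apply/funext => n; rewrite bk first_card_probE//.
  by rewrite -EFinM mulrDr.
rewrite E; apply: cvg_EFin; first exact: nearW.
apply: (cvg_eq (addr0 _)); apply: cvgD.
  apply: cvg_insertion_prob => //.
  have -> : (fun n => (k n)%:R / n.+1%:R) = (fun n => b n.+1 - n.+1%:R^-1).
    apply/funext => n; rewrite -[b n.+1](mulfK (_ : n.+1%:R != 0)) ?pnatr_eq0// bk.
    by rewrite -[X in _ - X]mul1r -mulrBl -[(k n).+1%:R]natr1 addrK.
  by apply: (cvg_eq (subr0 _)); apply: cvgB => //; exact: cvg_invS.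
apply: (cvg_argmin_prob_large c2) => //.
have : \forall n \near \oo, c <= Num.sqrt n.+1%:R / Num.sqrt (ln n.+1%:R) * b n.+1.
  by case: cb => N _ H; exists N => // n /= Nn; apply: H; exact: leqW.
move=> cbS; near=> n.
have n0 : (0 < n)%N by near: n; exists 1.
have : c <= Num.sqrt n.+1%:R / Num.sqrt (ln n.+1%:R) * b n.+1 by near: n.
have l0 : 0 < Num.sqrt (ln n.+1%:R) :> R by rewrite sqrtr_gt0 ln_gt0// ltr1n.
have s0 : 0 < Num.sqrt n.+1%:R :> R by rewrite sqrtr_gt0.
have s2 : n.+1%:R = Num.sqrt n.+1%:R ^+ 2 :> R by rewrite sqr_sqrtr.
rewrite -(ler_pM2r (mulr_gt0 s0 l0)) => /le_trans; apply.
rewrite -bk [in leRHS]s2.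
set s := Num.sqrt n.+1%:R; set l := Num.sqrt _.
rewrite le_eqVlt; apply/orP; left; apply/eqP.
by field; rewrite gt_eqF.
Unshelve. all: by end_near. Qed.

End first_card_prob_limits.

(** * Integrals against the measures of the theorem *)

Section density.
Local Open Scope ereal_scope.
Context d (T : measurableType d) (R : realType).
Variables (mu nu : {measure set T -> \bar R}) (D : set T) (g : T -> \bar R).
Hypotheses (mD : measurable D) (mg : measurable_fun D g).
Hypothesis g0 : forall x, D x -> 0 <= g x.
Hypothesis gfin : forall x, D x -> g x \is a fin_num.
Hypothesis nuE : forall A, measurable A ->
  nu (A `&` D) = \int[mu]_(x in A `&` D) g x.

(** First stage of the change of measure [nu = g mu] on [D]: indicators, then simple functions,
    monotone limits, and differences of positive and negative parts. *)
Let integral_density_indic E : measurable E ->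
  \int[nu]_(x in D) (\1_E x)%:E = \int[mu]_(x in D) ((\1_E x)%:E * g x).
Proof.
move=> mE; rewrite integral_indic// nuE// setIC integral_mkcondr.
apply: eq_integral => x _; rewrite patchE indicE.
by case: ifPn => xE; rewrite ?mul1e ?mul0e.
Qed.

Import HBNNSimple.

Let integral_density_nnsfun (f : {nnsfun T >-> R}) :
  \int[nu]_(x in D) (f x)%:E = \int[mu]_(x in D) ((f x)%:E * g x).
Proof.
under [LHS]eq_integral do rewrite fimfunE -fsumEFin//.
rewrite [LHS]ge0_integral_fsum//; last 2 first.
  - by move=> r; exact/measurable_EFinP/measurableT_comp.
  - by move=> n x _; rewrite EFinM nnfun_muleindic_ge0.
under [RHS]eq_integral.
  move=> x xD; rewrite fimfunE -fsumEFin// ge0_mule_fsuml; last first.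
    by move=> r; rewrite EFinM nnfun_muleindic_ge0.
  over.
have mind r : measurable_fun D (fun x => (\1_(f @^-1` [set r]) x)%:E : \bar R).
  exact/measurable_EFinP/measurable_indic.
rewrite [RHS]ge0_integral_fsum//; last 2 first.
  - move=> r; apply: emeasurable_funM => //.
    by apply/measurable_EFinP; apply: measurable_funM => //; exact/measurable_EFinP.
  - move=> r x Dx; rewrite EFinM mule_ge0//; last exact: g0.
    by rewrite nnfun_muleindic_ge0.
apply: eq_fsbigr => r _.
rewrite integralZl_indic_nnsfun//= integral_density_indic//.
have [r0|r0] := leP 0%R r.
  rewrite -ge0_integralZl//.
  - by apply: eq_integral => x _; rewrite EFinM muleA.
  - exact: emeasurable_funM.
  - by move=> x Dx; rewrite mule_ge0 ?g0// lee_fin.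
(* A nonnegative function does not take the negative value [r]. *)
have /eqP/seteqP[e _] : f @^-1` [set r] == set0.
  by rewrite preimage_nnfun0.
rewrite (_ : f @^-1` [set r] = set0); last by apply/seteqP; split.
rewrite !integral0_eq ?mule0// => x _; first by rewrite indic0 mulr0 mul0e.
by rewrite indic0 mul0e.
Qed.

Let ge0_integral_density (f : T -> \bar R) :
  measurable_fun D f -> (forall x, D x -> 0 <= f x) ->
  \int[nu]_(x in D) f x = \int[mu]_(x in D) (f x * g x).
Proof.
move=> mf f0; pose f_ := nnsfun_approx mD mf.
have ndf m n : (m <= n)%N -> forall x, (f_ m x <= f_ n x)%R.
  by move=> mn; exact/lefP/nd_nnsfun_approx.
transitivity (limn (fun n => \int[nu]_(x in D) (f_ n x)%:E)).
  rewrite -monotone_convergence//=.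
  - apply: eq_integral => x /[!inE] xD; apply/esym/cvg_lim => //=.
    exact: cvg_nnsfun_approx.
  - by move=> n; exact/measurable_EFinP/measurable_funTS.
  - by move=> n x _; rewrite lee_fin.
  - by move=> x _ m n mn; rewrite lee_fin; exact: ndf.
transitivity (limn (fun n => \int[mu]_(x in D) ((f_ n x)%:E * g x))).
  by apply: congr_lim; apply/funext => n; exact: integral_density_nnsfun.
rewrite -monotone_convergence//=.
- apply: eq_integral => x /[!inE] xD; apply/cvg_lim => //=.
  have fx : (f_ n x)%:E @[n --> \oo] --> f x by exact: cvg_nnsfun_approx.
  by apply: cvgeZr => //; exact: gfin.
- move=> n; apply: emeasurable_funM => //.
  exact/measurable_EFinP/measurable_funTS.
- by move=> n x Dx; rewrite mule_ge0 ?g0// lee_fin.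
- by move=> x Dx m n mn; rewrite lee_pmul ?g0// lee_fin//; exact: ndf.
Qed.

Lemma integral_density (f : T -> \bar R) : measurable_fun D f ->
  \int[nu]_(x in D) f x = \int[mu]_(x in D) (f x * g x).
Proof.
move=> mf; rewrite integralE [RHS]integralE; congr (_ - _).
  rewrite ge0_integral_density//; last exact: measurable_funepos.
  apply: eq_integral => x /[!inE] Dx.
  by rewrite !funeposE [LHS]muleC maxe_pMr ?gfin ?g0// mule0 [in RHS]muleC.
rewrite ge0_integral_density//; last exact: measurable_funeneg.
apply: eq_integral => x /[!inE] Dx.
by rewrite !funenegE [LHS]muleC maxe_pMr ?gfin ?g0// mule0 muleN [in RHS]muleC.
Qed.

End density.

(** * Integrals of functions of the first card as finite sums *)

Section law_sum.
Context {R : realType} {n : nat}.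
Local Notation P := (shuffle_law R (1%g : 'S_n.+1)).
Local Notation insertion_prob := (@insertion_prob R).
Local Notation argmin_prob := (@argmin_prob R).

Let first_set (k : nat) := [set s : 'S_n.+1 | (first_card s)%:R = k.+1%:R :> R].

Let sum_indic (h : nat -> R) (s : 'S_n.+1) :
  (h (s ord0))%:E = (\sum_(k < n.+1) (h k)%:E * (\1_(first_set k) s)%:E)%E.
Proof.
rewrite (bigD1 (s ord0))//= indicE mem_set// mule1 big1 ?adde0// => k ks.
rewrite indicE memNset ?mule0// => /eqP; rewrite eqr_nat /first_card eqSS.
by move=> /eqP sk; move/negP: ks; apply; apply/eqP/ord_inj.
Qed.

Let integrable_term (h : nat -> R) (k : nat) :
  P.-integrable setT (fun s => (h k)%:E * (\1_(first_set k) s)%:E)%E.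
Proof.
by apply: integrableZl => //; exact: integrable_indic.
Qed.

Lemma integrable_first_card (h : nat -> R) :
  P.-integrable setT (fun s : 'S_n.+1 => (h (s ord0))%:E).
Proof.
rewrite (funext (sum_indic h)).
by apply: integrable_sum => // k _; exact: integrable_term.
Qed.

Lemma integral_first_card (h : nat -> R) :
  (\int[P]_s (h (s ord0))%:E =
   (\sum_(k < n.+1) h k * (insertion_prob n k + argmin_prob n k))%:E)%E.
Proof.
rewrite (funext (sum_indic h)) integral_sum//=.
rewrite -sumEFin; apply: eq_bigr => k _.
rewrite integralZl//; last exact: integrable_indic.
rewrite integral_indic// setIT.
transitivity ((h k)%:E * first_card_prob n k.+1%:R)%E; first by [].
by rewrite first_card_probE// -ltnS.
Qed.

Lemma integral_first_card_over (a : R) (D : set (measurableTypeR R)) (f : R -> R) :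
  measurable D -> measurable_fun D f ->
  (forall k, (k <= n)%N -> D (k.+1%:R / a)) ->
  (\int[distribution P (first_card_over a)]_(x in D) (f x)%:E =
   (\sum_(k < n.+1) f (k.+1%:R / a) *
      (insertion_prob n k + argmin_prob n k))%:E)%E.
Proof.
move=> mD mf Dk; rewrite integral_mkcond.
have E : ((fun x => (f x)%:E) \_ D) \o first_card_over a =
    (fun s : 'S_n.+1 => (f ((s ord0).+1%:R / a))%:E).
  apply/funext => s; rewrite /= patchE mem_set//=.
  by apply: Dk; rewrite -ltnS.
rewrite integral_distribution.
- by rewrite -[RHS](integral_first_card (fun k => f (k.+1%:R / a))) E.
- by apply/(measurable_restrictT _ mD); exact/measurable_EFinP.
- by rewrite E; exact: (integrable_first_card (fun k => f (k.+1%:R / a))).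
Qed.

End law_sum.

(** * Weak limits *)

Section weighted_sums.
Context {R : realType}.
Local Notation leb := (@lebesgue_measure R).
Local Notation keep := (@keep R).
Local Notation argmin_prob := (@argmin_prob R).
Local Notation insertion_prob := (@insertion_prob R).
Local Notation T := (measurableTypeR R).

Lemma integral_patch (D E : set T) (h : T -> R) : E `<=` D ->
  (\int[leb]_(x in D) ((h \_ E) x)%:E = \int[leb]_(x in E) (h x)%:E)%E.
Proof.
move=> ED; rewrite -[in RHS](setIidr ED) integral_mkcondr.
by apply: eq_integral => x _; rewrite !patchE; case: ifPn.
Qed.

(** A Riemann sum on the scale [n.+1], with terms extended by 0 beyond [j = n]. The endpoints 0 and
    1 are left out as negligible. *)
Lemma cvg_sum_insertion (c : nat -> nat -> R) (M : R) (l : R -> R) :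
  (forall n j, `|c n j| <= M) ->
  measurable_fun (`[0%R, 1%R] : set T) l ->
  (forall x, 0 < x -> x < 1 ->
    c n (Num.truncn (x * n.+1%:R)) @[n --> \oo] --> l x) ->
  (\sum_(j < n.+1) c n j * insertion_prob n j)%:E @[n --> \oo]
    --> (\int[leb]_(x in `[0%R, 1%R]) (l x * expR (x - 1))%:E)%E.
Proof.
move=> cM ml cl.
have M0 : 0 <= M := le_trans (normr_ge0 _) (cM 0 0).
pose u n j := if (j <= n)%N then c n j * (n.+1%:R * insertion_prob n j) else 0.
rewrite -(@integral_patch `[0%R, +oo[); last first.
  by move=> x /=; rewrite !in_itv/= andbT => /andP[].
have -> : (fun n => (\sum_(j < n.+1) c n j * insertion_prob n j)%:E) =
    (fun n => (n.+1%:R^-1 * \sum_(j < n.+1) u n j)%:E).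
  apply/funext => n; rewrite mulr_sumr; congr EFin; apply: eq_bigr => j _.
  by rewrite /u -ltnS ltn_ord [RHS]mulrCA mulKf// pnatr_eq0.
apply: (@cvg_sum_integral _ u (fun n => n.+1%:R) S _ (M * expR 1)).
- by move=> n; rewrite ler1n.
- by move=> n j nj; rewrite /u leqNgt nj.
- move=> n j; rewrite /u; case: ifPn => jn; last first.
    by rewrite normr0 !mulr_ge0 ?expR_ge0.
  rewrite -mulrA normrM ler_pM// -expRD.
  rewrite ger0_norm; last by rewrite mulr_ge0 ?insertion_prob_ge0.
  rewrite /insertion_prob mulrC divfK ?pnatr_eq0//.
  (* The bound 1 is put in exponential form through [1 <= expR (1 - j / n.+1)]. *)
  apply: (@le_trans _ _ 1); first by rewrite exprn_ile1 ?keep_ge0 ?keep_le1.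
  rewrite -[leLHS]expR0 ler_expR subr_ge0 ler_pdivrMr// mul1r ler_nat.
  exact: leqW.
- apply: measurable_funTS; apply/(measurable_restrictT _ (measurable_itv _)).
  apply: measurable_funM => //; apply: measurable_funTS.
  by apply: measurableT_comp => //; exact: measurable_funB.
apply: (negligibleS _ (negligibleU (negligible_eq_ereal (0%:E : \bar R))
  (negligible_eq_ereal (1%:E : \bar R)))) => x /= nx.
apply: contrapT => /not_orP[x0 x1]; apply: nx => x0'.
have {x0 x0'} x0 : 0 < x.
  by rewrite lt_neqAle x0' andbT eq_sym; apply/eqP => xx; apply: x0; rewrite xx.
have [x1'|x1'|xx] := ltgtP x 1; last by exfalso; apply: x1; rewrite xx.
- rewrite patchE mem_set; last by rewrite /= in_itv/= !ltW.
  have jn n : (Num.truncn (x * n.+1%:R) <= n)%N.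
    by rewrite truncn_le_nat// gtr_pMl.
  rewrite (_ : (fun n => u n _) = (fun n => c n (Num.truncn (x * n.+1%:R)) *
      (n.+1%:R * insertion_prob n (Num.truncn (x * n.+1%:R))))); last first.
    by apply/funext => n; rewrite /u jn.
  apply: cvgM; first exact: cl.
  apply: cvg_insertion_prob => //.
  by apply: cvg_truncn => //; [exact: cvg_invS|exact: ltW].
- rewrite patchE memNset; last first.
    by rewrite /= in_itv/= => /andP[_]; rewrite leNgt x1'.
  apply: cvg_near_cst; apply: nearW => n; rewrite /u ifF//.
  apply/negbTE; rewrite -ltnNge truncn_ge_nat; last by rewrite mulr_ge0// ltW.
  by rewrite ler_peMl// ltW.
Qed.

(** The tail is a pointwise limit of step functions by [cvg_argmin_prob]; the factor [expR 1]
    cancels the [expR (-1)] of that limit. *)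
Lemma measurable_gauss_tail :
  measurable_fun (`[0%R, +oo[ : set T) (fun x : T => fine (gauss_tail x%:E)).
Proof.
pose k (x : R) n := Num.truncn (x * Num.sqrt n.+1%:R).
apply: (@measurable_fun_cvg _ T R _
  (fun n x => expR 1 * (Num.sqrt n.+1%:R * argmin_prob n (k x n)))).
  move=> n; apply: (@measurable_step _
    (fun j => expR 1 * (Num.sqrt n.+1%:R * argmin_prob n j)) (Num.sqrt n.+1%:R)).
move=> x /=; rewrite in_itv/= andbT => x0.
apply: (@cvg_eq _ _ (expR 1 * (expR (-1) * fine (gauss_tail x%:E)))).
  by rewrite mulrA -expRD subrr expR0 mul1r.
apply: cvgM; first exact: cvg_cst.
apply: cvg_argmin_prob; first by rewrite lee_fin.
apply: cvg_EFin; first exact: nearW.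
by apply: cvg_truncn => //; exact: cvg_inv_sqrtS.
Qed.

Lemma muF_densityE (x : R) : 0 <= x ->
  muF_density x = (expR (-1) * fine (gauss_tail x%:E))%:E.
Proof. by move=> x0; rewrite EFinM fineK// gauss_tail_fin_num// lee_fin. Qed.

Lemma argmin_prob_eq0 n k : (n <= k)%N -> argmin_prob n k = 0.
Proof. by move=> nk; rewrite /argmin_prob big_geq// mulr0. Qed.

(** A Riemann sum on the scale [sqrt n.+1], dominated through [argmin_prob_le], with pointwise
    limits from [cvg_argmin_prob]. *)
Lemma cvg_sum_argmin (c : nat -> nat -> R) (M : R) (l : R -> R) :
  (forall n j, `|c n j| <= M) ->
  measurable_fun (`[0%R, +oo[ : set T) l ->
  (forall x, 0 < x ->
    c n (Num.truncn (x * Num.sqrt n.+1%:R)) @[n --> \oo] --> l x) ->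
  (\sum_(j < n.+1) c n j * argmin_prob n j)%:E @[n --> \oo]
    --> (\int[leb]_(x in `[0%R, +oo[) ((l x)%:E * muF_density x))%E.
Proof.
move=> cM ml cl.
have M0 : 0 <= M := le_trans (normr_ge0 _) (cM 0 0).
pose s n : R := Num.sqrt n.+1%:R.
have s0 n : 0 < s n by rewrite sqrtr_gt0.
pose u n j := c n j * (s n * argmin_prob n j).
have -> : (fun n => (\sum_(j < n.+1) c n j * argmin_prob n j)%:E) =
    (fun n => ((s n)^-1 * \sum_(j < n.+1) u n j)%:E).
  apply/funext => n; rewrite mulr_sumr; congr EFin; apply: eq_bigr => j _.
  by rewrite /u [RHS]mulrCA mulKf// gt_eqF.
rewrite (eq_integral (fun x : T =>
    (l x * (expR (-1) * fine (gauss_tail x%:E)))%:E)); last first.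
  move=> x; rewrite inE/= in_itv/= andbT => x0.
  by rewrite muF_densityE// -EFinM.
apply: (@cvg_sum_integral _ u s S _ (M * (4 * expR 1))).
- by move=> n; rewrite -sqrtr1 ler_sqrt// ler1n.
- by move=> n j nj; rewrite /u argmin_prob_eq0 ?mulr0// ltnW.
- move=> n j; rewrite /u; have [->|n0] := posnP n.
    by rewrite argmin_prob_eq0// !mulr0 normr0 !mulr_ge0 ?expR_ge0.
  rewrite -mulrA normrM ler_pM// ger0_norm; first exact: argmin_prob_le.
  by rewrite mulr_ge0 ?argmin_prob_ge0// ltW.
- apply: measurable_funM => //; apply: measurable_funM => //.
  exact: measurable_gauss_tail.
apply: (negligibleS _ (negligible_eq_ereal (0%:E : \bar R))) => x /= nx.
apply: contrapT => x0; apply: nx => x0'.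
have {x0 x0'} x0 : 0 < x.
  by rewrite lt_neqAle x0' andbT eq_sym; apply/eqP => xx; apply: x0; rewrite xx.
apply: cvgM; first exact: cl.
apply: cvg_argmin_prob; first by rewrite lee_fin ltW.
apply: cvg_EFin; first exact: nearW.
by apply: cvg_truncn => //; [exact: cvg_inv_sqrtS|exact: ltW].
Qed.

(** With constant weights 1, the sums converge to the integral, while [sum_argmin_prob] identifies
    them with [keep n ^+ n.+1]; the limit is unique. *)
Lemma integral_muF_density :
  (\int[leb]_(x in `[0%R, +oo[) muF_density x = (expR (-1 : R))%:E)%E.
Proof.
transitivity (\int[leb]_(x in `[0%R, +oo[) (1%:E * muF_density x))%E.
  by apply: eq_integral => x _; rewrite mul1e.
have L : (\sum_(j < n.+1) 1 * argmin_prob n j)%:E @[n --> \oo] --> (expR (-1))%:E.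
  apply: cvg_EFin; first exact: nearW.
  apply: (@cvg_trans _ (keep n ^+ n.+1 @[n --> \oo])); last exact: cvg_keep.
  apply: near_eq_cvg; near=> n.
  have n0 : (0 < n)%N by near: n; exists 1.
  rewrite /= -sum_argmin_prob// big_ord_recr/= argmin_prob_eq0// mulr0 addr0.
  by apply: eq_bigr => j _; rewrite mul1r.
apply: cvg_unique L => //.
apply: (@cvg_sum_argmin (fun _ _ => 1) 1 (fun=> 1)) => //.
- by move=> n j; rewrite normr1.
- by move=> x _; exact: cvg_cst.
Unshelve. all: by end_near. Qed.

Lemma continuous_within_cvg (D : set R) (f : R -> R) (t : nat -> R) (x : R) :
  {within D, continuous f} -> D x -> t n @[n --> \oo] --> x ->
  (\forall n \near \oo, D (t n)) -> (f \_ D) (t n) @[n --> \oo] --> f x.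
Proof.
move=> /subspace_continuousP cf Dx tx Dt.
apply: (@cvg_trans _ (f (t n) @[n --> \oo])).
  by apply: near_eq_cvg; apply: filterS Dt => n Dtn; rewrite patchE mem_set.
apply: (cvg_comp t f) (cf x Dx) => A /=.
rewrite /within/= => xA.
have := tx _ xA => tA.
near=> n; have : D (t n) by near: n.
by near: n.
Unshelve. all: by end_near. Qed.

End weighted_sums.

Section weak_limits.
Context {R : realType}.
Local Notation leb := (@lebesgue_measure R).
Local Notation T := (measurableTypeR R).
Local Notation argmin_prob := (@argmin_prob R).
Local Notation insertion_prob := (@insertion_prob R).

Lemma bounded_funP (D : set R) (f : R -> R) (M : R) :
  (forall x, D x -> `|f x| <= M) -> [bounded f x | x in D].
Proof.
move=> fM; exists M; split; first exact: num_real.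
by move=> M' MM' x Dx; rewrite /= (le_trans (fM x Dx))// ltW.
Qed.

Lemma integral_mscale_dirac (k : {nonneg R}) (a : T) (D : set T) (f : R -> R) :
  measurable D -> measurable_fun D f -> D a ->
  (\int[mscale k (\d_a)]_(x in D) (f x)%:E = (k%:num * f a)%:E)%E.
Proof.
move=> mD mf Da.
have mEf : measurable_fun D (EFin \o f) by exact/measurable_EFinP.
rewrite integralE !ge0_integral_mscale//; last 2 first.
- exact: measurable_funeneg.
- exact: measurable_funepos.
rewrite !integral_dirac//; last 2 first.
- exact: measurable_funeneg.
- exact: measurable_funepos.
rewrite diracE mem_set// !mul1e -muleBr//; last first.
  by rewrite funeposE funenegE -EFinN -!EFin_max.
by rewrite EFinM; congr (_ * _)%E;
  exact: esym (congr1 (@^~ a) (funeposneg (EFin \o f))).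
Qed.

Lemma continuous_within_measurable (D : set R) (f : R -> R) :
  measurable (D : set T) -> {within D, continuous f} ->
  measurable_fun (D : set T) f.
Proof. by move=> mD cf; exact: subspace_continuous_measurable_fun. Qed.

Lemma exp_part_lty : (exp_part `[0%R, 1%R] < +oo :> \bar R)%E.
Proof.
rewrite /exp_part setIid.
have /integrableP[_] : leb.-integrable `[0%R, 1%R] (EFin \o (fun x : T => expR (x - 1))).
  apply: measurable_bounded_integrable => //.
  - by rewrite /= lebesgue_measure_itv/= lte_fin ltr01 -EFinB ltry.
  - by apply: measurable_funTS; apply: measurableT_comp => //; exact: measurable_funB.
  - apply: (@bounded_funP _ _ 1) => x /=; rewrite in_itv/= => /andP[_ x1].
    by rewrite ger0_norm ?expR_ge0// -[leRHS]expR0 ler_expR subr_le0.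
by under eq_integral do rewrite /= ger0_norm ?expR_ge0//.
Qed.

Lemma integral_nuF_lim (f : R -> R) (M : R) :
  measurable_fun (`[0%R, 1%R] : set T) f ->
  (forall x, `[0%R, 1%R]%classic x -> `|f x| <= M) ->
  (\int[nuF_lim R]_(x in `[0%R, 1%R]) (f x)%:E =
   \int[leb]_(x in `[0%R, 1%R]) (f x * expR (x - 1))%:E + (f 0 * expR (-1))%:E)%E.
Proof.
move=> mf fM.
have bf := bounded_funP fM.
have D0 : `[0%R, 1%R]%classic (0 : T) by rewrite /= in_itv/= lexx ler01.
rewrite integral_measure_add//; last 2 first.
- apply: measurable_bounded_integrable => //.
  rewrite -[X in (X < _)%E]/((expR (-1 : R))%:E * \d_(0%R : T) `[0%R, 1%R])%E.
  by rewrite diracE -EFinM ltry.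
- by apply: measurable_bounded_integrable => //; exact: exp_part_lty.
rewrite addeC; congr (_ + _)%E.
  rewrite (@integral_density _ _ _ leb _ `[0%R, 1%R] (fun x : T => (expR (x - 1))%:E))//.
  - apply: measurable_funTS; apply/measurable_EFinP/measurableT_comp => //.
    exact: measurable_funB.
  - by move=> A mA; rewrite /= /exp_part -setIA setIid.
  - exact/measurable_EFinP.
by rewrite integral_mscale_dirac//= mulrC.
Qed.

Lemma measurable_muF_density :
  measurable_fun (`[0%R, +oo[ : set T) (@muF_density R).
Proof.
apply: (@eq_measurable_fun _ _ _ _ _
    (fun x : T => (expR (-1) * fine (gauss_tail x%:E))%:E)).
  by move=> x; rewrite inE/= in_itv/= andbT => x0; rewrite muF_densityE.
apply/measurable_EFinP; apply: measurable_funM => //.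
exact: measurable_gauss_tail.
Qed.

Lemma muF_density_ge0 (x : R) : (0 <= muF_density x)%E.
Proof. by rewrite mule_ge0 ?lee_fin ?expR_ge0 ?gauss_tail_ge0. Qed.

Lemma integrable_muF_density : leb.-integrable `[0%R, +oo[ (@muF_density R).
Proof.
apply/integrableP; split; first exact: measurable_muF_density.
under eq_integral do rewrite gee0_abs ?muF_density_ge0//.
by rewrite integral_muF_density ltry.
Qed.

(** The insertion part yields the density [expR (x - 1)]. The argmin part lives at [j] of order
    [sqrt n], where [j / n] tends to 0, so it contributes [f 0] times the mass [expR (-1)]. *)
Lemma weak_limit_nuF : weak_limit `[0, 1] (nuF R) (nuF_lim R).
Proof.
move=> f cf [M fM].
have mf : measurable_fun (`[0%R, 1%R] : set T) f.
  exact: continuous_within_measurable.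
rewrite (integral_nuF_lim mf fM).
have D0 : `[0%R, 1%R]%classic (0 : R) by rewrite /= in_itv/= lexx ler01.
have M0 : 0 <= M := le_trans (normr_ge0 _) (fM 0 D0).
(* Cutting [f] off outside the interval keeps [c n j] bounded also for [j > n]. *)
pose c n j := (f \_ `[0, 1]) (j.+1%:R / n.+1%:R).
have cM n j : `|c n j| <= M.
  rewrite /c patchE; case: ifPn => [/set_mem/fM//|_].
  by rewrite /point/= normr0.
have Dk n j : (j <= n)%N -> `[0%R, 1%R]%classic (j.+1%:R / n.+1%:R : R).
  by move=> jn; rewrite /= in_itv/= divr_ge0//= ler_pdivrMr// mul1r ler_nat.
have -> : (fun n => \int[nuF R n]_(x in `[0%R, 1%R]) (f x)%:E)%E =
    (fun n => (\sum_(j < n.+1) c n j * insertion_prob n j)%:E +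
              (\sum_(j < n.+1) c n j * argmin_prob n j)%:E)%E.
  apply/funext => n; rewrite /nuF integral_first_card_over//; last exact: Dk.
  rewrite -EFinD -big_split/=; congr EFin; apply: eq_bigr => j _.
  by rewrite -mulrDr /c patchE mem_set//; apply: Dk; rewrite -ltnS.
apply: cvgeD; first by rewrite fin_num_adde_defl.
- apply: (cvg_sum_insertion cM mf) => x x0 x1.
  apply: continuous_within_cvg => //; first by rewrite /= in_itv/= !ltW.
    under eq_fun do rewrite -natr1 mulrDl mul1r.
    apply: (cvg_eq (addr0 _)); apply: cvgD; last exact: cvg_invS.
    by apply: cvg_truncn => //; [exact: cvg_invS|exact: ltW].
  apply: nearW => n; apply: Dk.
  by rewrite truncn_le_nat// gtr_pMl.
- have -> : (f 0 * expR (-1))%:E =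
      (\int[leb]_(x in `[0%R, +oo[) ((f 0)%:E * muF_density x))%E.
    by rewrite integralZl ?integral_muF_density//; exact: integrable_muF_density.
  apply: (cvg_sum_argmin (l := fun=> f 0) cM) => // x x0.
  pose k n := Num.truncn (x * Num.sqrt n.+1%:R).
  have kc : (k n)%:R / n.+1%:R @[n --> \oo] --> (0 : R).
    have -> : (fun n => (k n)%:R / n.+1%:R) =
        (fun n => (k n)%:R / Num.sqrt n.+1%:R * (Num.sqrt n.+1%:R)^-1) :> (nat -> R).
      apply/funext => n; rewrite -mulrA -invfM -expr2 sqr_sqrtr//.
    apply: (cvg_eq (mulr0 x)); apply: cvgM; last exact: cvg_inv_sqrtS.
    by apply: cvg_truncn => //; [exact: cvg_inv_sqrtS|exact: ltW].
  apply: continuous_within_cvg => //.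
    under eq_fun do rewrite -natr1 mulrDl mul1r.
    by apply: (cvg_eq (addr0 _)); apply: cvgD; last exact: cvg_invS.
  near=> n; apply: Dk; rewrite -/(k n) -ltnS -(ltr_nat R) -[ltRHS]mul1r.
  rewrite -ltr_pdivrMr//; near: n.
  exact: (cvgr_lt _ kc _ ltr01).
Unshelve. all: by end_near. Qed.

(** Beyond some [A] the values stay below 1, and on the compact interval up to [A] continuity gives
    a bound. *)
Lemma vanishing_bounded (f : R -> R) :
  {within `[0%R, +oo[, continuous f} ->
  (forall e : R, 0 < e -> exists M : R,
     forall x, `[0%R, +oo[%classic x -> M < `|x| -> `|f x| < e) ->
  exists M : R, forall x, `[0%R, +oo[%classic x -> `|f x| <= M.
Proof.
move=> cf /(_ 1 ltr01)[A fA].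
have cfA : {within `[0%R, A], continuous f}.
  by apply: continuous_subspaceW cf => x /=; rewrite !in_itv/= => /andP[->].
have [B [_ fB]] := compact_bounded (continuous_compact cfA (@segment_compact _ _ _)).
exists (Num.max 1 (B + 1)) => x Dx; rewrite le_max.
have x0 : 0 <= x by move: Dx; rewrite /= in_itv/= andbT.
have [Ax|xA] := ltP A x; first by rewrite ltW ?orbT// fA// ger0_norm.
apply/orP; right; apply: (fB (B + 1)); first by rewrite ltrDl.
by exists x => //=; rewrite in_itv/= x0.
Qed.

(** The argmin part yields the density. The insertion part lives at [j] of order [n], where
    [j / sqrt n] tends to infinity and [f] vanishes: this mass escapes. *)
Lemma weak_limit_muF : weak_limit_C0 `[0, +oo[ (muF R) (muF_lim R).
Proof.
move=> f cf f0.
have mf : measurable_fun (`[0%R, +oo[ : set T) f.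
  exact: continuous_within_measurable.
have [M fM] := vanishing_bounded cf f0.
have Dk n j : `[0%R, +oo[%classic (j.+1%:R / Num.sqrt n.+1%:R : R).
  by rewrite /= in_itv/= andbT divr_ge0// sqrtr_ge0.
pose c n j := f (j.+1%:R / Num.sqrt n.+1%:R).
have cM n j : `|c n j| <= M by exact: fM.
have -> : (fun n => \int[muF R n]_(x in `[0%R, +oo[) (f x)%:E)%E =
    (fun n => (\sum_(j < n.+1) c n j * insertion_prob n j)%:E +
              (\sum_(j < n.+1) c n j * argmin_prob n j)%:E)%E.
  apply/funext => n; rewrite /muF integral_first_card_over//.
  rewrite -EFinD -big_split/=; congr EFin; apply: eq_bigr => j _.
  by rewrite -mulrDr.
have -> : (\int[muF_lim R]_(x in `[0%R, +oo[) (f x)%:E =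
    0 + \int[leb]_(x in `[0%R, +oo[) ((f x)%:E * muF_density x))%E.
  rewrite add0e (@integral_density _ _ _ leb _ `[0%R, +oo[ muF_density)//.
  - exact: measurable_muF_density.
  - by move=> x _; exact: muF_density_ge0.
  - by move=> x /=; rewrite in_itv/= andbT => x0; rewrite muF_densityE.
  - by move=> A mA; rewrite /= /muF_lim -setIA setIid.
  - exact/measurable_EFinP.
apply: cvgeD => //.
- have -> : 0%E = (\int[leb]_(x in `[0%R, 1%R]) ((fun=> 0) x * expR (x - 1))%:E)%E :> \bar R.
    by apply/esym/integral0_eq => x _; rewrite mul0r.
  apply: (cvg_sum_insertion cM) => // x x0 _.
  apply/cvgrPdist_lt => e e0; have [A fA] := f0 _ e0.
  (* Once [(sqrt n.+1)^-1] is below this value, [x * sqrt n.+1] exceeds [A]. *)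
  have A1 : 0 < x / (`|A| + 1) by rewrite divr_gt0// ltr_wpDl.
  have xA := cvgr_lt _ cvg_inv_sqrtS _ A1.
  near=> n; rewrite sub0r normrN /c; apply: fA => //.
  have s0 : 0 < Num.sqrt n.+1%:R :> R by rewrite sqrtr_gt0.
  rewrite ger0_norm ?divr_ge0 ?sqrtr_ge0// ltr_pdivlMr//.
  apply: le_lt_trans (truncnS_gt _).
  have xs : (Num.sqrt n.+1%:R)^-1 < x / (`|A| + 1) by near: n; exact: xA.
  rewrite -[in leRHS](@sqr_sqrtr _ n.+1%:R)// expr2 mulrA ler_pM2r//.
  move: xs; rewrite ltr_pdivlMr ?ltr_wpDl// ltr_pdivrMl// mulrC => xs.
  by have := ler_norm A; lra.
- apply: (cvg_sum_argmin cM mf) => x x0.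
  apply: (@cvg_trans _ ((f \_ `[0%R, +oo[)
    ((Num.truncn (x * Num.sqrt n.+1%:R)).+1%:R / Num.sqrt n.+1%:R) @[n --> \oo])).
    by apply: near_eq_cvg; apply: nearW => n; rewrite patchE mem_set.
  apply: continuous_within_cvg => //; first by rewrite /= in_itv/= andbT ltW.
    under eq_fun do rewrite -natr1 mulrDl mul1r.
    apply: (cvg_eq (addr0 _)); apply: cvgD; last exact: cvg_inv_sqrtS.
    by apply: cvg_truncn => //; [exact: cvg_inv_sqrtS|exact: ltW].
  exact: nearW.
Unshelve. all: by end_near. Qed.

End weak_limits.

(** * Reduction of (i) to the common limit, and the limit on the scale [sqrt n] *)

Lemma cvg_first_card_prob_bulk (R : realType) (b : nat -> R) (beta : R) :
  0 < beta -> b n @[n --> \oo] --> beta ->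
  \forall n \near \oo, 2 <= Num.sqrt n%:R / Num.sqrt (ln n%:R) * b n.
Proof.
move=> beta0 bb.
have b2 : \forall n \near \oo, beta / 2 < b n.
  by apply: (cvgr_gt _ bb); rewrite ltr_pdivrMr// ltr_pMr// ltr1n.
(* Chosen so that [8 * sqrt n <= n * beta ^+ 2 / 4] for [n >= A]; the left side bounds
   [4 * ln n]. *)
pose A : R := (32 / beta ^+ 2) ^+ 2.
near=> n.
have n1 : (1 < n)%N by near: n; exists 2.
have nA : A <= n%:R.
  near: n; exists (Num.bound A) => // m /= Am.
  apply/ltW/(lt_le_trans (archi_boundP (sqr_ge0 _))).
  by rewrite ler_nat.
have bn : beta / 2 < b n by near: n.
have n0' : 0 < n%:R :> R by rewrite ltr0n; lia.
have r0 : 0 < Num.sqrt n%:R :> R by rewrite sqrtr_gt0.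
have r2 : Num.sqrt n%:R ^+ 2 = n%:R :> R by rewrite sqr_sqrtr// ltW.
(* From [ln n = 2 * ln (sqrt n)]. *)
have lnr : ln n%:R <= 2 * Num.sqrt n%:R :> R.
  rewrite -r2 lnXn// sqr_sqrtr ?sqrtr_ge0// mulr2n mulrDl mul1r.
  by rewrite lerD// ltW// ln_sublinear.
have ln0 : 0 < ln n%:R :> R by rewrite ln_gt0// ltr1n.
have l0 : 0 < Num.sqrt (ln n%:R) :> R by rewrite sqrtr_gt0.
have l2 : Num.sqrt (ln n%:R) ^+ 2 = ln n%:R :> R by rewrite sqr_sqrtr// ltW.
have rA : 32 <= beta ^+ 2 * Num.sqrt n%:R.
  rewrite mulrC -ler_pdivrMr ?exprn_gt0//.
  by rewrite -(ler_pXn2r (ltn0Sn 1)) ?nnegrE ?divr_ge0 ?exprn_ge0 ?sqrtr_ge0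
    ?(ltW beta0)// r2.
rewrite mulrAC ler_pdivlMr//.
apply: (@le_trans _ _ (Num.sqrt n%:R * (beta / 2))); last by rewrite ler_wpM2l// ltW.
rewrite -(ler_pXn2r (ltn0Sn 1)) ?nnegrE ?mulr_ge0 ?divr_ge0 ?sqrtr_ge0 ?(ltW beta0)//.
rewrite [leLHS]exprMn l2 [leRHS]exprMn expr_div_n.
apply: (@le_trans _ _ (8 * Num.sqrt n%:R)).
  move: lnr; set r := Num.sqrt _; set L := ln _; lra.
rewrite expr2 -mulrA [8 * _]mulrC ler_pM2l//.
move: rA; set r := Num.sqrt _; set B := beta ^+ 2; lra.
Unshelve. all: by end_near. Qed.

(** The insertion term is at most [n.+1%:R^-1], hence negligible on this scale. Counting cards from
    0 shifts the argument by [(sqrt n.+1)^-1], which vanishes in the limit. *)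
Lemma cvg_first_card_prob_sqrt (R : realType) (d : nat -> R) (delta : \bar R) :
  (forall n, (0 < n)%N -> card_number n (d n * Num.sqrt n%:R)) ->
  (0 <= delta)%E -> (d n)%:E @[n --> \oo] --> delta ->
  ((Num.sqrt n.+1%:R)%:E * first_card_prob n (d n.+1 * Num.sqrt n.+1%:R))%E
    @[n --> \oo] --> ((expR (-1))%:E * gauss_tail delta)%E.
Proof.
move=> dn delta0 dd.
have /choice[k kP] : forall n, exists k : nat,
    (k <= n)%N /\ d n.+1 * Num.sqrt n.+1%:R = k.+1%:R.
  move=> n; have [//|[|k] /andP[//k0 kn] ->] := dn n.+1.
  by exists k.
have kn n : (k n <= n)%N by have [] := kP n.
have s0 n : 0 < Num.sqrt n.+1%:R :> R by rewrite sqrtr_gt0.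
have E : (fun n => ((Num.sqrt n.+1%:R)%:E *
      first_card_prob n (d n.+1 * Num.sqrt n.+1%:R))%E) =
    (fun n => (Num.sqrt n.+1%:R * insertion_prob n (k n) +
               Num.sqrt n.+1%:R * argmin_prob n (k n))%:E).
  apply/funext => n; have [_ ->] := kP n; rewrite first_card_probE//.
  by rewrite -EFinM mulrDr.
rewrite E -(fineK (gauss_tail_fin_num delta0)) -EFinM.
apply: cvg_EFin; first exact: nearW.
apply: (cvg_eq (add0r _)); apply: cvgD.
  apply: (@squeeze_cvgr _ _ _ _ (fun=> 0) (fun n => (Num.sqrt n.+1%:R)^-1)).
  - apply: nearW => n; rewrite mulr_ge0 ?insertion_prob_ge0 ?sqrtr_ge0//=.
    rewrite -ler_pdivlMl// -invfM -expr2 sqr_sqrtr// /insertion_prob.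
    by rewrite ler_piMl// exprn_ile1 ?keep_ge0 ?keep_le1.
  - exact: cvg_cst.
  - exact: cvg_inv_sqrtS.
apply: cvg_argmin_prob => //.
have -> : (fun n => ((k n)%:R / Num.sqrt n.+1%:R)%:E) =
    (fun n => (d n.+1)%:E + (- (Num.sqrt n.+1%:R)^-1)%:E)%E.
  apply/funext => n; rewrite -EFinD; congr EFin.
  have [_ H] := kP n.
  by rewrite -[d n.+1](mulfK (lt0r_neq0 (s0 n))) H -[X in _ - X]mul1r -mulrBl
    -[(k n).+1%:R]natr1 addrK.
rewrite -[delta]adde0; apply: cvgeD; first by rewrite fin_num_adde_defl.
  by rewrite (cvg_shiftS (fun n => (d n)%:E)).
apply: cvg_EFin; first exact: nearW.
by apply: (cvg_eq (oppr0 _)); apply: cvgN; exact: cvg_inv_sqrtS.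
Qed.

Theorem theorem1 (R : realType) :
  (* (i) *)
  ((forall (b : nat -> R) (beta : R),
      (forall n, (0 < n)%N -> card_number n (b n * n%:R)) ->
      0 < beta -> beta <= 1 ->
      b n @[n --> \oo] --> beta ->
      (n.+1%:R%:E * first_card_prob n (b n.+1 * n.+1%:R))%E @[n --> \oo]
        --> (expR (beta - 1))%:E)
   /\ weak_limit `[0, 1] (nuF R) (nuF_lim R))
  /\
  (* (ii) *)
  (forall b : nat -> R,
      (forall n, (0 < n)%N -> card_number n (b n * n%:R)) ->
      b n @[n --> \oo] --> (0 : R) ->
      ((Num.sqrt 2)%:E
        < limn_einf (fun n => (Num.sqrt n%:R / Num.sqrt (ln n%:R) * b n)%:E))%E ->
      (n.+1%:R%:E * first_card_prob n (b n.+1 * n.+1%:R))%E @[n --> \oo]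
        --> (expR (-1))%:E)
  /\
  (* (iii) *)
  ((forall (d : nat -> R) (delta : \bar R),
      (forall n, (0 < n)%N -> card_number n (d n * Num.sqrt n%:R)) ->
      (0 <= delta)%E ->
      (d n)%:E @[n --> \oo] --> delta ->
      ((Num.sqrt n.+1%:R)%:E * first_card_prob n (d n.+1 * Num.sqrt n.+1%:R))%E @[n --> \oo]
        --> ((expR (-1))%:E * gauss_tail delta)%E)
   /\ weak_limit_C0 `[0, +oo[ (muF R) (muF_lim R)
   /\ muF_lim R `[0, +oo[ = (expR (-1))%:E).
Proof.
split; [split|split; [|split; [|split]]].
- move=> b beta bn beta0 _ bb.
  (* Any constant above [sqrt 2] would do; 2 is the one provided by [cvg_first_card_prob_bulk]. *)
  have sqrt2 : Num.sqrt 2 < 2 :> R.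
    rewrite -(ltr_pXn2r (ltn0Sn 1)) ?nnegrE ?sqrtr_ge0// sqr_sqrtr//.
    by rewrite expr2 -natrM ltr_nat.
  exact: cvg_first_card_prob sqrt2 (cvg_first_card_prob_bulk beta0 bb).
- exact: weak_limit_nuF.
- move=> b bn b0 /limn_einf_gt[c c2 cb].
  by have := cvg_first_card_prob bn b0 c2 cb; rewrite sub0r.
- exact: cvg_first_card_prob_sqrt.
- exact: weak_limit_muF.
- by rewrite /muF_lim setIid integral_muF_density.
Qed.
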